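(* Let $n$ be a positive integer, let $P\subset\mathbb{Z}^n$ be a polymatroid with rank function $f$, and let $\mathcal{P}=\mathrm{conv}(P)\subset\mathbb{R}^n$. (a) The polymatroid Tutte polynomial $\mathscr{T}_P(x,y)$ has degree $n$. (b) The coefficients of $\mathscr{T}_P(x,y+1)$ and of $\mathscr{T}_P(x+1,y)$ are non-negative integers, but $\mathscr{T}_P(x,y)$ always has both positive and negative coefficients. (c) $\mathscr{T}_P(x,y)$ is divisible by $(x+y-1)^{\mathrm{codim}(P)}$, where $\mathrm{codim}(P)=n-\dim(\mathcal{P})$. (d) The top homogeneous component of $\mathscr{T}_P(x,y)$ equals $(x+y)^n$. Equivalently, for all $k\in\{0,1,\dots,n\}$ the coefficient of $x^ky^{n-k}$ in $\mathscr{T}_P(x,y)$ is $\binom{n}{k}$. (e) For any polymatroid $Q\subset\mathbb{Z}^m$ ($m\ge 1$), $$\mathscr{T}_{P\oplus Q}(x,y)=\mathscr{T}_P(x,y)\,\mathscr{T}_Q(x,y)\quad\text{and}\quad \mathscr{T}_{P\boxplus Q}(x,y)=\frac{\mathscr{T}_P(x,y)\,\mathscr{T}_Q(x,y)}{x+y-1}.$$ (f) Let $i\in[n]$ and $r_i=f(\{i\})+f([n]\setminus\{i\})-f([n])$. For $\mathbf a\in\mathbb{Z}^n$ put $\widehat{\mathbf a}^{i}=(a_1,\ldots,a_{i-1},a_{i+1},\ldots,a_n)\in\mathbb{Z}^{n-1}$. If $r_i=0$, then $\mathscr{T}_P(x,y)=(x+y-1)\,\mathscr{T}_{\widehat P^{i}}(x,y)$,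 where $\widehat P^{i}=\{\widehat{\mathbf a}^{i}\mid\mathbf a\in P\}$. If $r_i=1$, then $$\mathscr{T}_P(x,y)=x\,\mathscr{T}_{P\setminus i}(x,y)+y\,\mathscr{T}_{P/i}(x,y),$$ where $P\setminus i=\{\widehat{\mathbf a}^{i}\mid\mathbf a\in P,\ a_i=f(\{i\})-1\}$ and $P/i=\{\widehat{\mathbf a}^{i}\mid\mathbf a\in P,\ a_i=f(\{i\})\}$. (g) $\mathscr{T}_P(1,1)=|P|=|\mathcal{P}\cap\mathbb{Z}^n|$ and $\mathscr{T}_P(0,0)=(-1)^{\mathrm{codim}(P)}\,|\mathcal{P}^\circ\cap\mathbb{Z}^n|$, where $\mathcal{P}^\circ$ is the relative interior of $\mathcal{P}$ (its interior in the affine subspace it spans). (h) Let $\Delta=\mathrm{conv}(\mathbf e_i\mid i\in[n])$, $\nabla=\mathrm{conv}(-\mathbf e_i\mid i\in[n])$, and consider the Minkowski differences $\mathcal{P}-\Delta=\{\mathbf a\in\mathbb{R}^n\mid\mathbf a+\Delta\subseteq\mathcal{P}\}$ and $\mathcal{P}-\nabla=\{\mathbf a\in\mathbb{R}^n\mid\mathbf a+\nabla\subseteq\mathcal{P}\}$. Then $$\frac{\mathscr{T}_P(x,y)}{x+y-1}\bigg|_{x=1,y=0}=|(\mathcal{P}-\Delta)\cap\mathbb{Z}^n|\quad\text{and}\quad\frac{\mathscr{T}_P(x,y)}{x+y-1}\bigg|_{x=0,y=1}=|(\mathcal{P}-\nabla)\cap\mathbb{Z}^n|.$$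
   Context: Notation: $[n]=\{1,\dots,n\}$; $\mathbf e_1,\dots,\mathbf e_n$ is the canonical basis of $\mathbb{R}^n$. A polymatroid in $\mathbb{Z}^n$ is a finite nonempty set $P\subset\mathbb{Z}^n$ satisfying the Exchange Axiom: for any $\mathbf a,\mathbf b\in P$ and any $i\in[n]$ with $a_i>b_i$, there exists $j\in[n]$ such that $a_j<b_j$ and both $\mathbf a-\mathbf e_i+\mathbf e_j$ and $\mathbf b+\mathbf e_i-\mathbf e_j$ belong to $P$. Its rank function is $f:2^{[n]}\to\mathbb{Z}$, $f(I)=\max_{\mathbf a\in P}\sum_{i\in I}a_i$. For $\mathbf a\in P$, an index $i\in[n]$ is internally active if there is no $j<i$ with $\mathbf a-\mathbf e_i+\mathbf e_j\in P$, and externally active if there is no $j<i$ with $\mathbf a+\mathbf e_i-\mathbf e_j\in P$. Let $\mathrm{Int}(\mathbf a),\mathrm{Ext}(\mathbf a)\subseteq[n]$ be the sets of internally, respectively externally, active indices. The polymatroid Tutte polynomial is $$\mathscr{T}_P(x,y)=\sum_{\mathbf a\in P}x^{|\mathrm{Int}(\mathbf a)\setminus\mathrm{Ext}(\mathbf a)|}\,y^{|\mathrm{Ext}(\mathbf a)\setminus\mathrm{Int}(\mathbf a)|}\,(x+y-1)^{|\mathrm{Int}(\mathbf a)\cap\mathrm{Ext}(\mathbf a)|}.$$ For $n\ge1$ it is divisible by $x+y-1$, since the index $1$ is always both internally and externally active. For $n=0$, the unique polymatroid in $\mathbb{Z}^0$ (a point) has Tutte polynomial $1$. For polymatroids $P\subset\mathbb{Z}^n$,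 $Q\subset\mathbb{Z}^m$, the direct sum and aggregated sum are the polymatroids $$P\oplus Q=\{(a_1,\ldots,a_n,b_1,\ldots,b_m)\mid\mathbf a\in P,\mathbf b\in Q\}\subset\mathbb{Z}^{n+m},$$ $$P\boxplus Q=\{(a_1+b_1,a_2,\ldots,a_n,b_2,\ldots,b_m)\mid\mathbf a\in P,\mathbf b\in Q\}\subset\mathbb{Z}^{n+m-1}.$$ In part (f), $\widehat P^{i}$ (when $r_i=0$) and $P\setminus i$, $P/i$ (when $r_i=1$) are polymatroids. *)

(* Defs.v *)
From HB Require Import structures.
From mathcomp Require Import all_boot all_order all_algebra.
From mathcomp Require Import finmap.
From mathcomp Require Import all_classical all_reals all_analysis.
(* The notations of mpoly clash with those of mathcomp-analysis. *)
From mathcomp Require mpoly.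
Export -(notations) mpoly.

Set Implicit Arguments.
Unset Strict Implicit.
Unset Printing Implicit Defensive.

Import Order.TTheory GRing.Theory Num.Theory.
Import numFieldNormedType.Exports.

Local Open Scope ring_scope.
Local Open Scope classical_set_scope.

(* The index set {1, ..., n} is 'I_n, so the smallest index is ord0. *)

Definition evec (R : pzSemiRingType) (n : nat) (i : 'I_n) : 'rV[R]_n :=
  delta_mx 0 i.

Definition polymatroid (n : nat) (P : {fset 'rV[int]_n}) : Prop :=
  P != fset0 /\
  forall a b : 'rV[int]_n, a \in P -> b \in P ->
  forall i : 'I_n, b 0 i < a 0 i ->
  exists j : 'I_n, [/\ a 0 j < b 0 j,
    a - evec int i + evec int j \in P & b + evec int i - evec int j \in P].

(* Since int has no least element, the maximum is seeded with the value at
   an element of P. *)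
Definition pm_rank (n : nat) (P : {fset 'rV[int]_n}) (I : {set 'I_n}) : int :=
  \big[Num.max/ \sum_(i in I) head 0 P 0 i]_(a <- P) \sum_(i in I) a 0 i.

Lemma pm_rank_ge (n : nat) (P : {fset 'rV[int]_n}) (I : {set 'I_n})
    (a : 'rV[int]_n) :
  a \in P -> \sum_(i in I) a 0 i <= pm_rank P I.
Proof. by move=> aP; rewrite /pm_rank (bigD1_seq a) ?fset_uniq //= le_max lexx. Qed.

Lemma pm_rank_attained (n : nat) (P : {fset 'rV[int]_n}) (I : {set 'I_n}) :
  P != fset0 -> exists2 a, a \in P & pm_rank P I = \sum_(i in I) a 0 i.
Proof.
move=> P0; rewrite /pm_rank big_seq.
elim/big_ind: _ => [|u v [a aP ->] [b bP ->]|a aP]; last by exists a.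
- exists (head 0 P) => //.
  case/fset0Pn: P0 => a; rewrite -[a \in P]/(a \in enum_fset P).
  rewrite -[head 0 P \in P]/(head 0 P \in enum_fset P).
  by case: (enum_fset P) => // b s _; rewrite mem_head.
- by rewrite /Num.max; case: ifP => _; [exists b | exists a].
Qed.

Definition int_active (n : nat) (P : {fset 'rV[int]_n}) (a : 'rV[int]_n) :
    {set 'I_n} :=
  [set i : 'I_n | ~~ [exists j : 'I_n,
      (j < i)%N && (a - evec int i + evec int j \in P)]]%SET.

Definition ext_active (n : nat) (P : {fset 'rV[int]_n}) (a : 'rV[int]_n) :
    {set 'I_n} :=
  [set i : 'I_n | ~~ [exists j : 'I_n,
      (j < i)%N && (a + evec int i - evec int j \in P)]]%SET.

Notation bipoly := (mpoly.mpoly 2 int).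

Definition polX : bipoly := mpolyX int (mnm1 (ord0 : 'I_2)).
Definition polY : bipoly := mpolyX int (mnm1 (ord_max : 'I_2)).

Definition tutte_poly (n : nat) (P : {fset 'rV[int]_n}) : bipoly :=
  \sum_(a <- P)
    polX ^+ #|(int_active P a :\: ext_active P a)%SET| *
    polY ^+ #|(ext_active P a :\: int_active P a)%SET| *
    (polX + polY - 1) ^+ #|(int_active P a :&: ext_active P a)%SET|.

(* The coefficient of x^k y^l. *)
Definition bicoef (p : bipoly) (k l : nat) : int :=
  mcoeff (Multinom [tuple k; l]) p.

Definition bisubst (p q r : bipoly) : bipoly := comp_mpoly [tuple q; r] p.

Definition bieval (p : bipoly) (s t : int) : int := meval (tnth [tuple s; t]) p.

(* msize is one plus the total degree, and 0 for the zero polynomial. *)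
Definition has_degree (p : bipoly) (d : nat) : Prop := msize p = d.+1.

Definition top_component (p : bipoly) : bipoly := pihomog mdeg (msize p).-1 p.

Definition bidvd (q p : bipoly) : Prop := exists s : bipoly, p = q * s.

Definition direct_sum (n m : nat) (P : {fset 'rV[int]_n})
    (Q : {fset 'rV[int]_m}) : {fset 'rV[int]_(n + m)} :=
  [fset row_mx a b | a in P, b in Q]%fset.

(* (a_1 + b_1, a_2, ..., a_n, b_2, ..., b_m) *)
Definition aggregate (n m : nat) (a : 'rV[int]_n.+1) (b : 'rV[int]_m.+1) :
    'rV[int]_(n.+1 + m) :=
  row_mx (a + b 0 ord0 *: evec int ord0) (col' ord0 b : 'rV[int]_m).

Definition aggregated_sum (n m : nat) (P : {fset 'rV[int]_n.+1})
    (Q : {fset 'rV[int]_m.+1}) : {fset 'rV[int]_(n.+1 + m)} :=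
  [fset aggregate a b | a in P, b in Q]%fset.

Definition pm_gap (n : nat) (P : {fset 'rV[int]_n}) (i : 'I_n) : int :=
  pm_rank P [set i]%SET + pm_rank P (~: [set i])%SET - pm_rank P [set: 'I_n]%SET.

Definition pm_projection (n : nat) (i : 'I_n) (P : {fset 'rV[int]_n}) :
    {fset 'rV[int]_n.-1} :=
  [fset col' i a | a in P]%fset.

Definition pm_deletion (n : nat) (i : 'I_n) (P : {fset 'rV[int]_n}) :
    {fset 'rV[int]_n.-1} :=
  [fset col' i a | a in P & a 0 i == (pm_rank P [set i]%SET - 1)%R]%fset.

Definition pm_contraction (n : nat) (i : 'I_n) (P : {fset 'rV[int]_n}) :
    {fset 'rV[int]_n.-1} :=
  [fset col' i a | a in P & a 0 i == pm_rank P [set i]%SET]%fset.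

Section Convexity.
Context {R : realType} {n : nat}.
Implicit Types S D : set 'rV[R]_n.

Definition affine_hull S : set 'rV[R]_n :=
  [set x | exists (k : nat) (p : 'I_k -> 'rV[R]_n) (w : 'I_k -> R),
     [/\ forall i, S (p i), \sum_i w i = 1 & x = \sum_i w i *: p i]].

Definition convex_hull S : set 'rV[R]_n :=
  [set x | exists (k : nat) (p : 'I_k -> 'rV[R]_n) (w : 'I_k -> R),
     [/\ forall i, S (p i), forall i, 0 <= w i,
         \sum_i w i = 1 & x = \sum_i w i *: p i]].

(* The linear subspace parallel to the affine hull of a nonempty S. *)
Definition direction S : {vspace 'rV[R]_n} :=
  xget 0%VS [set V : {vspace 'rV[R]_n} |
    [set` V] = [set x - y | x in affine_hull S & y in affine_hull S]].

Definition affine_dim S : nat := \dim (direction S).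

Definition affine_codim S : nat := (n - affine_dim S)%N.

Definition relative_interior S : set 'rV[R]_n :=
  interior (S : set (subspace (affine_hull S))).

Definition minkowski_difference S D : set 'rV[R]_n :=
  [set a | [set a + d | d in D] `<=` S].

Definition real_vector (a : 'rV[int]_n) : 'rV[R]_n := map_mx intr a.

Definition integer_points : set 'rV[R]_n := range real_vector.

Definition polytope (P : {fset 'rV[int]_n}) : set 'rV[R]_n :=
  convex_hull [set real_vector a | a in [set` P]].

Definition simplex : set 'rV[R]_n := convex_hull (range (@evec R n)).

Definition opp_simplex : set 'rV[R]_n :=
  convex_hull (range (fun i => - @evec R n i)).

(* fset_set sends infinite sets to fset0, hence the first conjunct. *)
Definition has_card S (k : nat) : Prop := finite_set S /\ #|` fset_set S| = k.

End Convexity.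

(* Main.v *)
Require Import Defs.
From mathcomp Require Import all_boot all_order all_algebra.
From mathcomp Require Import finmap.
From mathcomp Require Import all_classical all_reals all_analysis.
From mathcomp Require Import zify ring.

Set Implicit Arguments.
Unset Strict Implicit.
Unset Printing Implicit Defensive.

Import Order.TTheory GRing.Theory Num.Theory.
Import numFieldNormedType.Exports.

Local Open Scope ring_scope.
Local Open Scope classical_set_scope.

(** Let an edge i -> j at a point a of P mean that a - e_i + e_j lies in P.
    Everything rests on one consequence of the exchange axiom,
    [exchange_two]: a difference of two points of P that is a sum of two
    exchanges splits into two edges.  It makes the edges at a transitive
    ([edge_trans]) and describes how they change when a moves along an edge
    ([edge_shift]).  Moreover all of P is reached from a by directions that are
    edges at a ([exchange_connected]), so that a linear functional which no
    edge at a decreases is minimal at a.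

    Activities.  An index is internally active iff it has no edge to a smaller
    index, externally active iff it has no edge from a smaller index.  The
    summand of a point is the product over all indices of
    1 + [internally active] (x - 1) + [externally active] (y - 1).

    The sum does not depend on the order of the indices ([ordered_tutte_swap]).
    When two neighbours p, q of the order are exchanged, only their two factors
    change, and the summand at a changes by D(a) ([p -> q] - [q -> p]), where D
    takes the same value at a and at a - e_p + e_q when both are in P.  The sum
    of these changes over P telescopes to 0.  Hence any index i may be assumed
    to be the last one; then the activities of the others are those of the
    slice of constant a_i, and i is internally (externally) active iff a_i is
    minimal (maximal) on P.  This expands the polynomial along the slices
    ([slice_expansion]).  If a_i takes one value or two values this is the
    recursion of part (f).  In general the two extreme slices contribute
    factors x and y and the others no linear term, so that by induction the top
    component is (x + y)^n, which gives (a) and (d).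

    In (b), only the negative coefficient is not visible from the definition.
    The factor x + y - 1 vanishes at (1, 0), so the coefficients of the pure
    powers of x sum to 0, although that of x^n is 1.  For (e), the edges of a
    direct sum stay inside the blocks; in an aggregated sum an edge between the
    blocks passes through the shared index, which is the smallest one in both,
    so activities are again those of the summands.

    Geometry.  Every index that is not active in both ways is joined by an
    edge to a smaller one.  Therefore the direction space of the polytope and
    the e_i with i active in both ways span the whole space, and the
    codimension is at most the number of such i ([codim_le_active]): this is
    (c).  Lattice points of the polytope lie in P ([polytope_integer]), because
    at a point b of P closest to such a lattice point c, the set of indices
    reached by edges from those with b_i > c_i carries a coordinate sum that is
    minimal at b, but smaller at c.

    At (0, 0) only the points with equal sets of active indices survive.  These
    are the points at which every edge can be reversed ([active_reversible]),
    which are the lattice points of the relative interior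
    ([relint_reversible]); at such a point the direction space is described
    exactly by the classes of the edge relation, and the codimension is the
    number of active indices ([codim_reversible]).  This gives (g).  After
    division by x + y - 1, only the points whose sole externally active index is
    the smallest index o survive at (1, 0).  By transitivity they are the points
    a with a - e_o + e_i in P for all i, that is, the translates by e_o of the
    lattice points of the Minkowski difference with the simplex.  Evaluating at
    (0, 1) is the mirror image, and this is (h). *)

(** * Exchanges as edges *)
Ltac row_entries := apply/rowP => ?; rewrite ?mxE; ring.

Definition edge (n : nat) (P : {fset 'rV[int]_n}) (a : 'rV[int]_n)
    (i j : 'I_n) : bool :=
  a - evec int i + evec int j \in P.

Definition coord_sum (n : nat) (a : 'rV[int]_n) : int := \sum_i a 0 i.

Lemma sum_evec (A : pzSemiRingType) (n : nat) (U : pred 'I_n) (j : 'I_n) :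
  \sum_(i | U i) evec A j 0 i = (U j)%:R.
Proof.
rewrite /evec; case Uj: (U j).
  rewrite (bigD1 j) //= mxE !eqxx big1 ?addr0 // => i /andP[_ ij].
  by rewrite mxE (negbTE ij).
by rewrite big1 // => i; rewrite mxE eqxx /=; case: eqVneq => // ->; rewrite Uj.
Qed.

Lemma edge_self (n : nat) (P : {fset 'rV[int]_n}) (a : 'rV[int]_n) i :
  edge P a i i = (a \in P).
Proof. by rewrite /edge subrK. Qed.

Lemma edge_opposite (n : nat) (P : {fset 'rV[int]_n}) (a : 'rV[int]_n) i j :
  (a + evec int i - evec int j \in P) = edge P a j i.
Proof. by rewrite /edge; congr (_ \in P); row_entries. Qed.

Section Exchange.
Variables (n : nat) (P : {fset 'rV[int]_n}).
Hypothesis polyP : polymatroid P.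
Implicit Types (a b : 'rV[int]_n) (i j p q u v : 'I_n).

Lemma polymatroid_exchange a b i : a \in P -> b \in P -> b 0 i < a 0 i ->
  exists j, [/\ a 0 j < b 0 j, edge P a i j & edge P b j i].
Proof.
move=> aP bP lt; have [j [? ? h]] := polyP.2 a b aP bP i lt.
by exists j; split; rewrite // -edge_opposite.
Qed.

(** Unless s is u or v, and the two given points already form the edges, the
    coordinate s is larger at the second point; the exchange axiom applies to
    it, and only u and v can compensate.  Allowing coincidences among s, t, u, v
    is what the applications need: two exchanges often leave the same index. *)
Lemma exchange_two a s t u v :
  a \in P -> a + evec int s + evec int t - evec int u - evec int v \in P ->
  (edge P a u s && edge P a v t) || (edge P a v s && edge P a u t).
Proof.
set b := (X in X \in P) => aP bP.
case: (eqVneq s u) => [su|su].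
  apply/orP; left; rewrite su edge_self aP /= /edge.
  by move: bP; rewrite /b su; congr (_ \in P); row_entries.
case: (eqVneq s v) => [sv|sv].
  apply/orP; right; rewrite sv edge_self aP /= /edge.
  by move: bP; rewrite /b sv; congr (_ \in P); row_entries.
have [|k [blt e1 e2]] := polymatroid_exchange bP aP (i := s).
  rewrite /b /evec !mxE !eqxx (negbTE su) (negbTE sv) /=.
  case: (s == t) => /=; lia.
have : (k == u) || (k == v).
  move: blt; rewrite /b /evec !mxE !eqxx /=.
  by case: (k == s); case: (k == t); case: (k == u); case: (k == v) => //=; lia.
case/orP => /eqP ek; rewrite ek in e1 e2.
- rewrite e2 /=; apply/orP; left; move: e1; rewrite /edge /b.
  by congr (_ \in P); row_entries.
- rewrite e2 /=; apply/orP; right; move: e1; rewrite /edge /b.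
  by congr (_ \in P); row_entries.
Qed.

(** Seen from b = a - e_i + e_j, the point a - e_j + e_k is reached by the two
    exchanges j -> i and j -> k.  So j -> k is an edge at b, and it leads to
    a - e_i + e_k. *)
Lemma edge_trans a i j k : edge P a i j -> edge P a j k -> edge P a i k.
Proof.
move=> eij ejk; set b := a - evec int i + evec int j.
have : (edge P b j i && edge P b j k) || (edge P b j i && edge P b j k).
  apply: exchange_two => //; move: ejk; rewrite /edge /b.
  by congr (_ \in P); row_entries.
rewrite orbb => /andP[_]; rewrite /edge /b.
by congr (_ \in P); row_entries.
Qed.

(** An edge u -> v at a survives the move of a along q -> p, unless u and v
    interact with q and p: the alternative in [exchange_two] is that the two
    exchanges can be recombined into q -> v and u -> p. *)
Lemma edge_shift a p q u v : a \in P -> edge P a q p -> edge P a u v ->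
  edge P (a - evec int q + evec int p) u v || (edge P a q v && edge P a u p).
Proof.
move=> aP eqp euv; set b := a - evec int u + evec int v.
have /orP[/andP[_]|/andP[]] :
    (edge P b v u && edge P b q p) || (edge P b q u && edge P b v p).
- apply: exchange_two => //; move: eqp; rewrite /edge /b.
  by congr (_ \in P); row_entries.
- rewrite /edge /b => h; apply/orP; left; move: h.
  by congr (_ \in P); row_entries.
- rewrite /edge /b => h1 h2; apply/orP; right; apply/andP; split.
  + by move: h1; congr (_ \in P); row_entries.
  + by move: h2; congr (_ \in P); row_entries.
Qed.

Definition dist a b : nat := (\sum_i `|(a 0 i - b 0 i)%R|)%N.

Lemma dist_exchange a b i j : b 0 i < a 0 i -> a 0 j < b 0 j ->
  (dist (a - evec int i + evec int j) b < dist a b)%N.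
Proof.
move=> lti ltj; rewrite /dist.
have ij : i != j by apply: contraTneq lti => ->; rewrite -leNgt ltW.
rewrite (bigD1 i) // (bigD1 j) 1?eq_sym //= [X in (_ < X)%N](bigD1 i) //.
rewrite [X in (_ < _ + X)%N](bigD1 j) 1?eq_sym //=.
rewrite (eq_bigr (fun k => `|(a 0 k - b 0 k)%R|%N)); last first.
  move=> k /andP[ki kj]; rewrite /evec !mxE (negbTE ki) (negbTE kj).
  by congr (`|_|%N); rewrite /=; ring.
rewrite !mxE !eqxx (negbTE ij) eq_sym (negbTE ij) /=.
by move: (bigop _ _ _) => N; lia.
Qed.

Lemma exchange_exists a b : a \in P -> b \in P -> a != b ->
  exists i j, [/\ b 0 i < a 0 i, a 0 j < b 0 j, edge P a i j & edge P b j i].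
Proof.
move=> aP bP ab.
have [k abk] : exists k, a 0 k != b 0 k.
  apply/existsP; apply: contraNT ab; rewrite negb_exists => /forallP eq.
  by apply/eqP/rowP => k; apply/eqP; rewrite -[_ == _]negbK eq.
case: (ltgtP (a 0 k) (b 0 k)) abk => // lt _.
- have [j [? ? ?]] := polymatroid_exchange bP aP lt.
  by exists j, k.
- have [j [? ? ?]] := polymatroid_exchange aP bP lt.
  by exists k, j.
Qed.

(** An induction principle: P is connected to a by steps which go against an
    edge of a itself, whatever the current point is.  The exchange axiom gives
    the step with the endpoint at a, and the distance to a decreases. *)
Lemma exchange_connected a (Q : 'rV[int]_n -> Prop) : a \in P -> Q a ->
  (forall b i j, edge P a i j -> Q (b - evec int j + evec int i) -> Q b) ->
  forall b, b \in P -> Q b.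
Proof.
move=> aP Qa step b; have [m] := ubnP (dist b a).
elim: m b => // m IH b lem bP.
have [-> //|ba] := eqVneq b a.
have [i [j [lti ltj e1 e2]]] := exchange_exists bP aP ba.
apply: (step b j i) => //; apply: IH => //.
by rewrite (leq_trans _ (ltnSE lem)) // dist_exchange.
Qed.

Lemma coord_sum_const a b : a \in P -> b \in P -> coord_sum a = coord_sum b.
Proof.
move=> aP; move: b; apply: (exchange_connected aP) => //.
move=> b i j _ ->; rewrite /coord_sum.
transitivity (\sum_k (b 0 k + (evec int i 0 k - evec int j 0 k))).
  by apply: eq_bigr => k _; rewrite !mxE; ring.
by rewrite big_split sumrB !sum_evec /= subrr addr0.
Qed.

(** Local optimality implies global optimality for the coordinate sum over U:
    no edge at a leaves U, so no edge at a decreases this sum. *)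
Lemma closed_set_minimal (U : pred 'I_n) a :
  a \in P -> (forall i j, edge P a i j -> U i -> U j) ->
  forall b, b \in P -> \sum_(k | U k) a 0 k <= \sum_(k | U k) b 0 k.
Proof.
move=> aP clU; apply: (exchange_connected aP) => // b i j eij.
set x := \sum_(k | U k) a 0 k => h.
apply: (le_trans h); rewrite -subr_ge0 -sumrB.
rewrite (eq_bigr (fun k => evec int j 0 k - evec int i 0 k)); last first.
  by move=> k _; rewrite !mxE; ring.
rewrite sumrB !sum_evec; have := clU _ _ eij.
by case: (U i); case: (U j) => // /(_ isT).
Qed.

End Exchange.

(** * Activities with respect to an order of the indices *)

(** The values at the four pairs of booleans are 1, x, y and x + y - 1.  The
    affine form makes sums of such factors easy to compute. *)
Definition activity_factor (A : comPzRingType) (x y : A) (b c : bool) : A :=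
  1 + (x - 1) *+ b + (y - 1) *+ c.

(** The order of the indices is the order of their keys. *)
Section ActivityOrder.
Variables (n : nat) (key : 'I_n -> nat).
Implicit Types (P : {fset 'rV[int]_n}) (a : 'rV[int]_n) (i l : 'I_n).

Definition loses P a l : bool :=
  [exists j, (key j < key l)%N && edge P a l j].

Definition gains P a l : bool :=
  [exists j, (key j < key l)%N && edge P a j l].

Definition weight P a : bipoly :=
  \prod_l activity_factor polX polY (~~ loses P a l) (~~ gains P a l).

Definition ordered_tutte P : bipoly := \sum_(a <- P) weight P a.

End ActivityOrder.

Lemma int_activeE (n : nat) (P : {fset 'rV[int]_n}) a l :
  (l \in int_active P a) = ~~ loses (@nat_of_ord n) P a l.
Proof. by rewrite inE. Qed.

Lemma ext_activeE (n : nat) (P : {fset 'rV[int]_n}) a l :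
  (l \in ext_active P a) = ~~ gains (@nat_of_ord n) P a l.
Proof.
by rewrite inE; congr (~~ _); apply: eq_existsb => j; rewrite edge_opposite.
Qed.

Lemma weightE (n : nat) (P : {fset 'rV[int]_n}) (a : 'rV[int]_n) :
  weight (@nat_of_ord n) P a = \prod_l
    activity_factor polX polY (l \in int_active P a) (l \in ext_active P a).
Proof. by apply: eq_bigr => l _; rewrite int_activeE ext_activeE. Qed.

Lemma prod_activity_factor (I : finType) (A B : {set I}) :
  \prod_l activity_factor polX polY (l \in A) (l \in B) =
  polX ^+ #|A :\: B|%SET * polY ^+ #|B :\: A|%SET *
  (polX + polY - 1) ^+ #|A :&: B|%SET.
Proof.
have prod_if (C : {set I}) (z : bipoly) :
    z ^+ #|C| = \prod_l (if l \in C then z else 1).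
  by rewrite -big_mkcond prodr_const.
rewrite !prod_if -!big_split /=.
apply: eq_bigr => l _; rewrite !inE /activity_factor.
by case: (l \in A); case: (l \in B) => /=; ring.
Qed.

Lemma tutte_polyE (n : nat) (P : {fset 'rV[int]_n}) :
  tutte_poly P = ordered_tutte (@nat_of_ord n) P.
Proof. by apply: eq_bigr => a _; rewrite weightE prod_activity_factor. Qed.

Lemma eq_ordered_tutte (n : nat) (key1 key2 : 'I_n -> nat)
    (P : {fset 'rV[int]_n}) :
  (forall i j, (key1 i < key1 j)%N = (key2 i < key2 j)%N) ->
  ordered_tutte key1 P = ordered_tutte key2 P.
Proof.
move=> eqk; apply: eq_bigr => a _; apply: eq_bigr => l _.
by congr (activity_factor polX polY (~~ _) (~~ _)); apply: eq_existsb => j; rewrite eqk.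
Qed.

(** * Independence of the order *)

(** The change of the two factors when p and q are exchanged.  The booleans dp
    and dq say that p and q have an edge to a smaller index, up and uq that
    they have an edge from one; the hypotheses are the transitivity of edges.
    The coefficient on the right depends only on dp || dq and up || uq, which
    is what makes the sum over P telescope. *)
Lemma swap_identity (A : comPzRingType) (x y : A)
    (dp dq up uq epq eqp : bool) :
  (epq -> dq -> dp) -> (eqp -> dp -> dq) ->
  (epq -> up -> uq) -> (eqp -> uq -> up) ->
  activity_factor x y (~~ dp) (~~ up) * activity_factor x y (~~ (dq || eqp)) (~~ (uq || epq)) -
  activity_factor x y (~~ (dp || epq)) (~~ (up || eqp)) * activity_factor x y (~~ dq) (~~ uq) =
  (if dp || dq then if up || uq then 0 else - (y * (y - 1))
   else if up || uq then x * (x - 1) else (x - y) * (x + y - 1)) *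
  (epq%:R - eqp%:R).
Proof.
have xE : activity_factor x y true false = x by rewrite /activity_factor /=; ring.
have yE : activity_factor x y false true = y by rewrite /activity_factor /=; ring.
have zE : activity_factor x y true true = x + y - 1 by rewrite /activity_factor /=; ring.
have oE : activity_factor x y false false = 1 by rewrite /activity_factor /=; ring.
move: (activity_factor x y) xE yE zE oE => f xE yE zE oE.
by case: epq; case: eqp; case: dp; case: dq; case: up; case: uq;
  move=> /= h1 h2 h3 h4;
  first [by have := h1 isT isT | by have := h2 isT isT
        | by have := h3 isT isT | by have := h4 isT isT
        | rewrite ?(xE, yE, zE, oE); ring].
Qed.

Section AdjacentSwap.
Variables (n : nat) (P : {fset 'rV[int]_n}) (key key' : 'I_n -> nat).
Variables (p q : 'I_n).
Hypothesis polyP : polymatroid P.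
Hypotheses (key_inj : injective key) (key'_inj : injective key').
Hypothesis key_q : key q = (key p).+1.
Hypothesis key'_p : key' p = (key p).+2.
Hypothesis key'E : forall l, l != p -> key' l = key l.
Implicit Types (a : 'rV[int]_n) (i j l u v : 'I_n).

Let below j := (key j < key p)%N.
Let down a l := [exists j, below j && edge P a l j].
Let up a l := [exists j, below j && edge P a j l].

Let pq : p != q.
Proof. by apply/eqP => epq; move: key_q; rewrite epq; lia. Qed.

(* In both orders the indices below the pair are the same; the other member
   of the pair counts as smaller for exactly one of p and q. *)
Let key_lt j l : (key j < key l)%N =
  if l == p then below j else if l == q then below j || (j == p)
  else (key j < key l)%N.
Proof.
rewrite /below; case: (eqVneq l p) => [-> //|lp].
case: (eqVneq l q) => [->|//]; rewrite key_q ltnS leq_eqVlt orbC.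
by rewrite (inj_eq key_inj).
Qed.

Let key'_lt j l : (key' j < key' l)%N =
  if l == p then below j || (j == q) else if l == q then below j
  else (key j < key l)%N.
Proof.
rewrite /below.
have notq i : i != q -> key i <> (key p).+1.
  by move=> iq; rewrite -key_q => /key_inj /eqP; rewrite (negbTE iq).
have notp i : i != p -> key i <> key p.
  by move=> ip /key_inj /eqP; rewrite (negbTE ip).
have notp' i : i != p -> key i <> (key p).+2.
  move=> ip; rewrite -(key'E ip) -key'_p => /key'_inj /eqP.
  by rewrite (negbTE ip).
case: (eqVneq l p) => [->|lp].
  rewrite key'_p; case: (eqVneq j p) => [->|jp].
    by rewrite key'_p (negbTE pq); lia.
  rewrite (key'E jp); case: (eqVneq j q) => [->|jq]; first by rewrite key_q; lia.
  by have := notq _ jq; have := notp _ jp; lia.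
rewrite (key'E lp); case: (eqVneq l q) => [->|lq].
  rewrite key_q; case: (eqVneq j p) => [->|jp]; first by rewrite key'_p; lia.
  by rewrite (key'E jp); have := notp _ jp; lia.
case: (eqVneq j p) => [->|jp]; last by rewrite (key'E jp).
have := notq _ lq; have := notp _ lp; have := notp' _ lp.
by rewrite key'_p; lia.
Qed.

Let exists_or1 (J R : pred 'I_n) i :
  [exists j, (J j || (j == i)) && R j] = [exists j, J j && R j] || R i.
Proof.
apply/existsP/orP => [[j /andP[/orP[Jj|/eqP-> Ri]]]|[/existsP[j /andP[Jj Rj]]|Ri]].
- by move=> Rj; left; apply/existsP; exists j; rewrite Jj.
- by right.
- by exists j; rewrite Jj.
- by exists i; rewrite eqxx orbT.
Qed.

Let qp : (q == p) = false.
Proof. by rewrite eq_sym (negbTE pq). Qed.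

Let loses_p a : loses key P a p = down a p.
Proof. by apply: eq_existsb => j; rewrite key_lt eqxx. Qed.
Let gains_p a : gains key P a p = up a p.
Proof. by apply: eq_existsb => j; rewrite key_lt eqxx. Qed.
Let loses_q a : loses key P a q = down a q || edge P a q p.
Proof.
by rewrite -exists_or1; apply: eq_existsb => j; rewrite key_lt eqxx qp.
Qed.
Let gains_q a : gains key P a q = up a q || edge P a p q.
Proof.
by rewrite -(exists_or1 _ (edge P a ^~ q)); apply: eq_existsb => j; rewrite key_lt eqxx qp.
Qed.
Let loses'_q a : loses key' P a q = down a q.
Proof. by apply: eq_existsb => j; rewrite key'_lt eqxx qp. Qed.
Let gains'_q a : gains key' P a q = up a q.
Proof. by apply: eq_existsb => j; rewrite key'_lt eqxx qp. Qed.
Let loses'_p a : loses key' P a p = down a p || edge P a p q.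
Proof.
by rewrite -exists_or1; apply: eq_existsb => j; rewrite key'_lt eqxx.
Qed.
Let gains'_p a : gains key' P a p = up a p || edge P a q p.
Proof.
by rewrite -(exists_or1 _ (edge P a ^~ p)); apply: eq_existsb => j; rewrite key'_lt eqxx.
Qed.

Let rest a : bipoly := \prod_(l | (l != p) && (l != q))
  activity_factor polX polY (~~ loses key P a l) (~~ gains key P a l).

Let weight_split a : weight key P a =
  activity_factor polX polY (~~ down a p) (~~ up a p) *
  activity_factor polX polY (~~ (down a q || edge P a q p)) (~~ (up a q || edge P a p q))
  * rest a.
Proof.
rewrite /weight (bigD1 p) //= (bigD1 q) 1?eq_sym //= mulrA.
by rewrite loses_p gains_p loses_q gains_q.
Qed.

Let weight'_split a : weight key' P a =
  activity_factor polX polY (~~ (down a p || edge P a p q)) (~~ (up a p || edge P a q p))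
  * activity_factor polX polY (~~ down a q) (~~ up a q) * rest a.
Proof.
rewrite /weight (bigD1 p) //= (bigD1 q) 1?eq_sym //= mulrA.
rewrite loses'_p gains'_p loses'_q gains'_q; congr (_ * _).
apply: eq_bigr => l /andP[lp lq]; congr (activity_factor polX polY (~~ _) (~~ _)).
  by apply: eq_existsb => j; rewrite key'_lt (negbTE lp) (negbTE lq).
by apply: eq_existsb => j; rewrite key'_lt (negbTE lp) (negbTE lq).
Qed.

Let down_edge a u v : edge P a u v -> down a v -> down a u.
Proof.
move=> euv /existsP[j /andP[Jj e]]; apply/existsP; exists j; rewrite Jj /=.
exact: edge_trans e.
Qed.

Let up_edge a u v : edge P a u v -> up a u -> up a v.
Proof.
move=> euv /existsP[j /andP[Jj e]]; apply/existsP; exists j; rewrite Jj /=.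
exact: edge_trans euv.
Qed.

(* The pair as a whole has an edge to, or from, the indices below it. *)
Let movable_down a := down a p || down a q.
Let movable_up a := up a p || up a q.

Let boundary a : bipoly :=
  if movable_down a then
    if movable_up a then 0 else - (polY * (polY - 1))
  else if movable_up a then polX * (polX - 1)
  else (polX - polY) * (polX + polY - 1).

Let weight_diff a :
  weight key P a - weight key' P a =
  boundary a * rest a * ((edge P a p q)%:R - (edge P a q p)%:R).
Proof.
rewrite weight_split weight'_split /boundary -mulrBl -mulrA (mulrC (rest a)) mulrA.
by congr (_ * _); apply: swap_identity; do ?[exact: down_edge | exact: up_edge].
Qed.

Let slide (r s : 'I_n) a := a - evec int r + evec int s.

Let slide_back r s a : slide s r (slide r s a) = a.
Proof. by rewrite /slide; row_entries. Qed.

Let below_or_above l : l != p -> l != q ->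
  below l \/ (key p < key l)%N && (key q < key l)%N.
Proof.
move=> lp lq; have npl : key l <> key p by move/key_inj/eqP; rewrite (negbTE lp).
have nql : key l <> key q by move/key_inj/eqP; rewrite (negbTE lq).
by rewrite /below; move: npl nql key_q; lia.
Qed.

Let swapped (r s : 'I_n) := (r == p) && (s == q) || (r == q) && (s == p).

Let swappedC r s : swapped r s -> swapped s r.
Proof. by rewrite /swapped orbC andbC [X in _ || X]andbC. Qed.

Let movable_downE a r s : swapped r s -> movable_down a = down a r || down a s.
Proof. by case/orP => /andP[/eqP-> /eqP->] //; rewrite orbC. Qed.

Let movable_upE a r s : swapped r s -> movable_up a = up a r || up a s.
Proof. by case/orP => /andP[/eqP-> /eqP->] //; rewrite orbC. Qed.

Let edge_from_slide a r s j : edge P (slide r s a) s j = edge P a r j.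
Proof. by rewrite /edge /slide; congr (_ \in P); row_entries. Qed.

Let edge_to_slide a r s j : edge P (slide r s a) j r = edge P a j s.
Proof. by rewrite /edge /slide; congr (_ \in P); row_entries. Qed.

Let edge_slide_back a r s : a \in P -> edge P (slide r s a) s r.
Proof. by rewrite edge_from_slide edge_self. Qed.

Let down_slide_imp a r s : swapped r s -> edge P a r s ->
  movable_down a -> movable_down (slide r s a).
Proof.
move=> rs ers; rewrite !(movable_downE _ rs) => h.
have {h} : down a r by case/orP: h => // /(down_edge ers).
case/existsP=> j /andP[Jj e]; apply/orP; right; apply/existsP; exists j.
by rewrite Jj edge_from_slide.
Qed.

Let up_slide_imp a r s : swapped r s -> edge P a r s ->
  movable_up a -> movable_up (slide r s a).
Proof.
move=> rs ers; rewrite !(movable_upE _ rs) => h.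
have {h} : up a s by case/orP: h => // /(up_edge ers).
case/existsP=> j /andP[Jj e]; apply/orP; left; apply/existsP; exists j.
by rewrite Jj edge_to_slide.
Qed.

Let down_slide a r s : swapped r s -> a \in P -> edge P a r s ->
  movable_down (slide r s a) = movable_down a.
Proof.
move=> rs aP ers; apply/idP/idP; last exact: down_slide_imp.
rewrite -{2}(slide_back r s a); apply: down_slide_imp; first exact: swappedC.
exact: edge_slide_back.
Qed.

Let up_slide a r s : swapped r s -> a \in P -> edge P a r s ->
  movable_up (slide r s a) = movable_up a.
Proof.
move=> rs aP ers; apply/idP/idP; last exact: up_slide_imp.
rewrite -{2}(slide_back r s a); apply: up_slide_imp; first exact: swappedC.
exact: edge_slide_back.
Qed.

(* If the pair is not movable both down and up, then by [edge_shift] the edges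
   between indices below the pair do not notice a move inside the pair. *)
Let edge_slide_below a r s u v : swapped r s -> a \in P -> edge P a r s ->
  ~~ (movable_down a && movable_up a) -> below u -> below v ->
  edge P a u v -> edge P (slide r s a) u v.
Proof.
move=> rs aP ers; rewrite (movable_downE _ rs) (movable_upE _ rs) => nDU Ju Jv e.
have /orP[//|/andP[erv eus]] := edge_shift polyP aP ers e.
move: nDU; rewrite negb_and !negb_or.
by case/orP=> /andP[/existsPn h1 /existsPn h2];
  [have := h1 v | have := h2 u]; rewrite ?Ju ?Jv ?erv ?eus.
Qed.

Let pair_below r s l : swapped r s -> l != p -> l != q -> ~~ below l ->
  (key r < key l)%N && (key s < key l)%N.
Proof.
move=> rs lp lq nl; have [h|] := below_or_above lp lq; first by rewrite h in nl.
by case/orP: rs => /andP[/eqP-> /eqP->] //; rewrite andbC.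
Qed.

(* For an index above the pair the exception of [edge_shift] is harmless: the
   exchange then goes to a member of the pair instead, which is still smaller. *)
Let loses_slide_imp a r s l : swapped r s -> a \in P -> edge P a r s ->
  ~~ (movable_down a && movable_up a) -> l != p -> l != q ->
  loses key P a l -> loses key P (slide r s a) l.
Proof.
move=> rs aP ers nDU lp lq /existsP[j /andP[jl e]].
case Jl: (below l).
  apply/existsP; exists j; rewrite jl /=; apply: edge_slide_below => //.
  exact: ltn_trans Jl.
have /orP[h|/andP[_ h]] := edge_shift polyP aP ers e.
  by apply/existsP; exists j; rewrite jl.
have /andP[rl _] := pair_below rs lp lq (negbT Jl).
by apply/existsP; exists r; rewrite rl edge_to_slide.
Qed.

Let gains_slide_imp a r s l : swapped r s -> a \in P -> edge P a r s ->
  ~~ (movable_down a && movable_up a) -> l != p -> l != q ->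
  gains key P a l -> gains key P (slide r s a) l.
Proof.
move=> rs aP ers nDU lp lq /existsP[j /andP[jl e]].
case Jl: (below l).
  apply/existsP; exists j; rewrite jl /=; apply: edge_slide_below => //.
  exact: ltn_trans Jl.
have /orP[h|/andP[h _]] := edge_shift polyP aP ers e.
  by apply/existsP; exists j; rewrite jl.
have /andP[_ sl] := pair_below rs lp lq (negbT Jl).
by apply/existsP; exists s; rewrite sl edge_from_slide.
Qed.

Let rest_slide a r s : swapped r s -> a \in P -> edge P a r s ->
  ~~ (movable_down a && movable_up a) -> rest (slide r s a) = rest a.
Proof.
move=> rs aP ers nDU; apply: eq_bigr => l /andP[lp lq].
have nDU' : ~~ (movable_down (slide r s a) && movable_up (slide r s a)).
  by rewrite down_slide // up_slide.
have sr := swappedC rs; have esr := edge_slide_back r s aP.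
congr (activity_factor polX polY (~~ _) (~~ _)); apply/idP/idP.
- by rewrite -{2}(slide_back r s a); apply: loses_slide_imp.
- exact: loses_slide_imp.
- by rewrite -{2}(slide_back r s a); apply: gains_slide_imp.
- exact: gains_slide_imp.
Qed.

(* [weight_diff] reads density a * ([p -> q] - [q -> p]). *)
Let density a := boundary a * rest a.

Let density_slide a r s : swapped r s -> a \in P -> edge P a r s ->
  density (slide r s a) = density a.
Proof.
move=> rs aP ers; rewrite /density /boundary.
rewrite down_slide // up_slide //.
case nDU: (movable_down a && movable_up a).
  by case/andP: nDU => -> ->; rewrite !mul0r.
by rewrite rest_slide // nDU.
Qed.

Let density_sum r s : swapped r s ->
  \sum_(a <- P) density a *+ edge P a r s =
  \sum_(a <- P | edge P a r s) density (slide r s a).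
Proof.
move=> rs; rewrite [RHS]big_mkcond /= big_seq [RHS]big_seq.
apply: eq_bigr => a aP; case e: (edge P a r s) => //.
by rewrite density_slide.
Qed.

(** The points with an edge p -> q and those with an edge q -> p are in
    bijection by the move along the edge, and the density is preserved. *)
Lemma ordered_tutte_swap : ordered_tutte key P = ordered_tutte key' P.
Proof.
apply/eqP; rewrite -subr_eq0 -sumrB.
under eq_bigr do rewrite weight_diff mulrBr !mulr_natr.
rewrite sumrB subr_eq0; apply/eqP.
have rs : swapped p q by rewrite /swapped !eqxx.
rewrite -2!/(density _) (density_sum rs).
transitivity (\sum_(b <- [seq b <- P | edge P b q p]) density b); last first.
  by rewrite big_filter big_mkcond; apply: eq_bigr => b _; rewrite mulrb.
rewrite -big_filter -(big_map (slide p q) xpredT density).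
apply: perm_big; apply: uniq_perm => [||b].
- by rewrite map_inj_uniq ?filter_uniq ?fset_uniq //; apply: can_inj (slide_back p q).
- by rewrite filter_uniq ?fset_uniq.
apply/mapP/idP => [[a]|].
  rewrite !mem_filter => /andP[e aP] ->.
  by rewrite edge_slide_back //= -[_ \in _]/(edge P a p q).
rewrite mem_filter => /andP[e bP]; exists (slide q p b); last by rewrite slide_back.
by rewrite mem_filter edge_slide_back //= -[_ \in _]/(edge P b q p).
Qed.

End AdjacentSwap.

(** * Expansion along the slices of one coordinate *)

(** The even numbers keep the natural order of the other indices; the odd
    number 2 k + 1 puts i between k and k + 1.  Raising k by one exchanges i
    with a neighbour. *)
Definition moved_key (n : nat) (i : 'I_n) (k : nat) (j : 'I_n) : nat :=
  if j == i then k.*2.+1 else j.*2.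

Lemma moved_key_inj (n : nat) (i : 'I_n) k : injective (moved_key i k).
Proof.
move=> j l; rewrite /moved_key; case: eqVneq => [->|_]; case: eqVneq => [->|_];
  by [move/eqP; lia | move=> ?; apply: val_inj => /=; lia].
Qed.

(** Starting from k = i, which is the natural order, the index i is moved up
    by exchanging it with its successors one at a time. *)
Lemma tutte_moved_key (n : nat) (i : 'I_n) (P : {fset 'rV[int]_n}) (k : nat) :
  polymatroid P -> (i <= k < n)%N ->
  tutte_poly P = ordered_tutte (moved_key i k) P.
Proof.
move=> polyP; elim: k => [|k IH] /andP[ik kn].
  rewrite tutte_polyE; apply: eq_ordered_tutte => a b.
  by rewrite /moved_key -!val_eqE /=; case: eqP => ?; case: eqP => ?; lia.
have [ei|ki] := eqVneq (i : nat) k.+1.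
  rewrite tutte_polyE; apply: eq_ordered_tutte => a b.
  by rewrite /moved_key -!val_eqE /=; case: eqP => ?; case: eqP => ?; lia.
rewrite IH; last by apply/andP; lia.
apply: (@ordered_tutte_swap _ _ _ _ i (Ordinal kn)) => //.
- exact: moved_key_inj.
- exact: moved_key_inj.
- by rewrite /moved_key eqxx -val_eqE /= eq_sym (negbTE ki).
- by rewrite /moved_key eqxx.
- by move=> l li; rewrite /moved_key (negbTE li).
Qed.

Section Slices.
Variables (n : nat) (i : 'I_n.+1).
Implicit Types (P : {fset 'rV[int]_n.+1}) (a : 'rV[int]_n.+1) (b : 'rV[int]_n).

Definition slice (t : int) P : {fset 'rV[int]_n} :=
  [fset col' i a | a in P & a 0 i == t]%fset.

Definition insert (t : int) b : 'rV[int]_n.+1 :=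
  \row_j oapp (fun k => b 0 k) t (unlift i j).

Lemma insert_at t b : insert t b 0 i = t.
Proof. by rewrite mxE unlift_none. Qed.

Lemma insert_lift t b k : insert t b 0 (lift i k) = b 0 k.
Proof. by rewrite mxE liftK. Qed.

Lemma insert_col' a : insert (a 0 i) (col' i a) = a.
Proof. by apply/rowP => j; rewrite mxE; case: unliftP => [k|] -> //=; rewrite mxE. Qed.

Lemma col'_insert t b : col' i (insert t b) = b.
Proof. by apply/rowP => k; rewrite mxE insert_lift. Qed.

Lemma mem_slice t P b : (b \in slice t P) = (insert t b \in P).
Proof.
apply/imfsetP/idP => [[a /= /andP[aP /eqP <-] ->]|h]; first by rewrite insert_col'.
by exists (insert t b); rewrite ?col'_insert //= inE h insert_at /=.
Qed.

(** A slice sees exactly the edges of P that avoid the index i, so the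
    activities of the remaining indices are the same in P and in the slice,
    provided that i is not smaller than any of them. *)
Lemma edge_slice P t b j k :
  edge (slice t P) b j k = edge P (insert t b) (lift i j) (lift i k).
Proof.
rewrite /edge mem_slice; congr (_ \in P); apply/rowP => l.
case: (unliftP i l) => [l'|] ->.
  by rewrite insert_lift !mxE !(inj_eq lift_inj) liftK.
by rewrite !mxE !eqxx !(negbTE (neq_lift _ _)) unlift_none /=; ring.
Qed.

Lemma polymatroid_slice P a : polymatroid P -> a \in P ->
  polymatroid (slice (a 0 i) P).
Proof.
move=> polyP aP; split.
  by apply/fset0Pn; exists (col' i a); rewrite mem_slice insert_col'.
move=> b c; rewrite !mem_slice => bP cP k lt.
have [|l [ltl e1 e2]] := polymatroid_exchange polyP bP cP (i := lift i k).
  by rewrite !insert_lift.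
case: (unliftP i l) ltl e1 e2 => [l'|] ->; last by rewrite !insert_at ltxx.
rewrite !insert_lift -!edge_slice => ? ? ?; exists l'; split => //.
by rewrite edge_opposite.
Qed.

Definition coord_values P : {fset int} :=
  [fset (a : 'rV[int]_n.+1) 0 i | a in P]%fset.

Definition is_min P t : bool := all (fun a => t <= a 0 i) P.
Definition is_max P t : bool := all (fun a => a 0 i <= t) P.

Lemma lt_moved_key_self (j : 'I_n.+1) :
  (moved_key i n j < moved_key i n i)%N = (j != i).
Proof.
rewrite /moved_key eqxx; case: eqVneq => [_|_] /=; first by rewrite ltnn.
by have := ltn_ord j; lia.
Qed.

Lemma lt_moved_key_lift (j : 'I_n.+1) k :
  (moved_key i n j < moved_key i n (lift i k))%N =
  if unlift i j is Some l then (l < k)%N else false.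
Proof.
have liftN m : (lift i m == i) = false by rewrite eq_sym (negbTE (neq_lift _ _)).
rewrite /moved_key liftN.
case: unliftP => [l|] ->; last by rewrite eqxx; have := ltn_ord (lift i k); lia.
by rewrite liftN ltn_double /= ltnNge leq_bump2 -ltnNge.
Qed.

(** If a_i is not minimal, the exchange axiom against a point with a smaller
    a_i gives an edge from i, and any other index is smaller than i. *)
Lemma loses_last P a : polymatroid P -> a \in P ->
  ~~ loses (moved_key i n) P a i = is_min P (a 0 i).
Proof.
move=> polyP aP; rewrite negb_exists; apply/forallP/allP => [h b bP|h j].
  rewrite leNgt; apply/negP => lt.
  have [j [ltj e _]] := polymatroid_exchange polyP aP bP lt.
  have := h j; rewrite lt_moved_key_self e andbT negbK => /eqP ej.
  by move: ltj; rewrite ej ltNge ltW.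
rewrite lt_moved_key_self negb_and negbK; case: eqVneq => //= ji.
apply/negP => /h; rewrite /evec !mxE !eqxx eq_sym (negbTE ji) /=; lia.
Qed.

Lemma gains_last P a : polymatroid P -> a \in P ->
  ~~ gains (moved_key i n) P a i = is_max P (a 0 i).
Proof.
move=> polyP aP; rewrite negb_exists; apply/forallP/allP => [h b bP|h j].
  rewrite leNgt; apply/negP => lt.
  have [j [ltj _ e]] := polymatroid_exchange polyP bP aP lt.
  have := h j; rewrite lt_moved_key_self e andbT negbK => /eqP ej.
  by move: ltj; rewrite ej ltNge ltW.
rewrite lt_moved_key_self negb_and negbK; case: eqVneq => //= ji.
apply/negP => /h; rewrite /evec !mxE !eqxx eq_sym (negbTE ji) /=; lia.
Qed.

Lemma weight_last P a : polymatroid P -> a \in P ->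
  weight (moved_key i n) P a =
  activity_factor polX polY (is_min P (a 0 i)) (is_max P (a 0 i)) *
  weight (@nat_of_ord n) (slice (a 0 i) P) (col' i a).
Proof.
move=> polyP aP; rewrite /weight (bigD1_ord i) //= loses_last // gains_last //.
congr (_ * _); apply: eq_bigr => k _; congr (activity_factor _ _ (~~ _) (~~ _)).
- apply/existsP/existsP => [[j]|[j]].
    rewrite lt_moved_key_lift; case: unliftP => [l|] -> //= e.
    by exists l; rewrite edge_slice insert_col'.
  by exists (lift i j); rewrite lt_moved_key_lift liftK -[a]insert_col' -edge_slice.
- apply/existsP/existsP => [[j]|[j]].
    rewrite lt_moved_key_lift; case: unliftP => [l|] -> //= e.
    by exists l; rewrite edge_slice insert_col'.
  by exists (lift i j); rewrite lt_moved_key_lift liftK -[a]insert_col' -edge_slice.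
Qed.

Lemma sum_slice (V : nmodType) P t (F : 'rV[int]_n -> V) :
  \sum_(a <- P | (a : 'rV[int]_n.+1) 0 i == t) F (col' i a) = \sum_(b <- slice t P) F b.
Proof.
rewrite -big_filter -(big_map (col' i) xpredT F); apply: perm_big.
have inj : {in [seq a <- P | (a : 'rV[int]_n.+1) 0 i == t] &, injective (col' i)}.
  move=> a b; rewrite !mem_filter => /andP[/eqP ta _] /andP[/eqP tb _] e.
  by rewrite -(insert_col' a) -(insert_col' b) e ta tb.
apply: uniq_perm => [||b]; rewrite ?fset_uniq //.
  by rewrite map_inj_in_uniq ?filter_uniq ?fset_uniq.
rewrite -[RHS]/(b \in slice t P) mem_slice; apply/mapP/idP => [[a]|bP].
  by rewrite mem_filter => /andP[/eqP <- aP] ->; rewrite insert_col'.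
by exists (insert t b); rewrite ?col'_insert // mem_filter insert_at eqxx.
Qed.

Lemma slice_expansion P : polymatroid P ->
  tutte_poly P = \sum_(t <- coord_values P)
    activity_factor polX polY (is_min P t) (is_max P t) *
    tutte_poly (slice t P).
Proof.
move=> polyP; rewrite (tutte_moved_key (i := i) (k := n)) //; last first.
  by rewrite -ltnS ltn_ord leqnn.
rewrite /ordered_tutte (partition_big_imfset _ (fun a : 'rV[int]_n.+1 => a 0 i)).
apply: eq_bigr => t _; rewrite tutte_polyE mulr_sumr -sum_slice.
rewrite big_seq_cond [RHS]big_seq_cond; apply: eq_bigr => a /andP[aP /eqP <-].
exact: weight_last.
Qed.

End Slices.

(** * Deletion and contraction *)

Section Gap.
Variables (n : nat) (i : 'I_n.+1) (P : {fset 'rV[int]_n.+1}).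
Hypothesis polyP : polymatroid P.

Lemma mem_coord_values a : a \in P -> a 0 i \in coord_values i P.
Proof. by move=> aP; apply/imfsetP; exists a. Qed.

Lemma is_minP t : reflect (forall a, a \in P -> t <= a 0 i) (is_min i P t).
Proof. exact: allP. Qed.

Lemma is_maxP t : reflect (forall a, a \in P -> a 0 i <= t) (is_max i P t).
Proof. exact: allP. Qed.

(** The coordinate sum is constant on P, so the rank of the complement of i is
    that constant minus the minimum of a_i, and the gap is the width of P in
    the direction i. *)
Lemma pm_gapE : let hi := pm_rank P [set i]%SET in
  exists lo : int, [/\ lo \in coord_values i P, is_min i P lo,
    hi \in coord_values i P, is_max i P hi & pm_gap P i = hi - lo].
Proof.
have P0 := polyP.1; move=> hi.
have hiE (a : 'rV[int]_n.+1) : \sum_(k in [set i]%SET) a 0 k = a 0 i by rewrite big_set1.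
have [a aP ha] := pm_rank_attained [set i]%SET P0.
have [b bP hb] := pm_rank_attained (~: [set i])%SET P0.
have [c cP hc] := pm_rank_attained [set: 'I_n.+1]%SET P0.
have complE (x : 'rV[int]_n.+1) : \sum_(k in (~: [set i])%SET) x 0 k = coord_sum x - x 0 i.
  rewrite /coord_sum [in RHS](bigD1 i) //= [RHS]addrC addKr.
  by apply: eq_bigl => k; rewrite !inE.
exists (b 0 i); split.
- exact: mem_coord_values.
- apply/is_minP => x xP; have := pm_rank_ge (~: [set i])%SET xP.
  by rewrite hb !complE (coord_sum_const polyP xP bP) lerD2l lerN2.
- by rewrite /hi ha hiE mem_coord_values.
- by apply/is_maxP => x xP; have := pm_rank_ge [set i]%SET xP; rewrite hiE.
rewrite /pm_gap -/hi hb complE hc (coord_sum_const polyP bP cP).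
have -> : \sum_(k in [set: 'I_n.+1]%SET) c 0 k = coord_sum c.
  by apply: eq_bigl => k; rewrite inE.
ring.
Qed.

Lemma coord_values_bounds (lo hi t : int) : is_min i P lo -> is_max i P hi ->
  t \in coord_values i P -> lo <= t <= hi.
Proof.
by move=> /is_minP h1 /is_maxP h2 /imfsetP[a /= aP ->]; rewrite h1 ?h2.
Qed.

Lemma is_min_in (lo t : int) : lo \in coord_values i P -> is_min i P lo ->
  t \in coord_values i P -> is_min i P t = (t == lo).
Proof.
move=> loV hlo tV; apply/idP/eqP => [|-> //] ht; apply/eqP.
rewrite eq_le; case/imfsetP: loV => a /= aP ea.
have /imfsetP[b /= bP eb] := tV.
by rewrite {1}ea {2}eb (is_minP _ ht) // (is_minP _ hlo).
Qed.

Lemma is_max_in (hi t : int) : hi \in coord_values i P -> is_max i P hi ->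
  t \in coord_values i P -> is_max i P t = (t == hi).
Proof.
move=> hiV hhi tV; apply/idP/eqP => [|-> //] ht; apply/eqP.
rewrite eq_le; case/imfsetP: hiV => a /= aP ea.
have /imfsetP[b /= bP eb] := tV.
by rewrite {1}eb {2}ea (is_maxP _ hhi) // (is_maxP _ ht).
Qed.

Lemma tutte_gap0 : pm_gap P i = 0 ->
  tutte_poly P = (polX + polY - 1) * tutte_poly (pm_projection i P).
Proof.
have [lo [loV hlo hiV hhi ->]] := pm_gapE; set hi := pm_rank _ _ in hiV hhi *.
move/eqP; rewrite subr_eq0 => /eqP ehl.
have -> : pm_projection i P = slice i hi P.
  apply/fsetP => b; rewrite mem_slice; apply/imfsetP/idP => [[a /= aP ->]|bP].
    suff <- : a 0 i = hi by rewrite insert_col'.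
    apply/eqP; have := coord_values_bounds hlo hhi (mem_coord_values aP).
    by rewrite ehl eq_le andbC.
  by exists (insert i hi b) => //; rewrite col'_insert.
rewrite (slice_expansion i polyP).
have -> : coord_values i P = [fset hi]%fset.
  apply/fsetP => t; rewrite inE; apply/idP/eqP => [tV|-> //]; apply/eqP.
  by have := coord_values_bounds hlo hhi tV; rewrite ehl eq_le andbC.
rewrite big_seq_fset1 hhi ehl hlo /activity_factor /=; congr (_ * _); ring.
Qed.

Lemma tutte_gap1 : pm_gap P i = 1 ->
  tutte_poly P = polX * tutte_poly (pm_deletion i P) +
                 polY * tutte_poly (pm_contraction i P).
Proof.
have [lo [loV hlo hiV hhi ->]] := pm_gapE.
rewrite -[pm_deletion i P]/(slice i (pm_rank P [set i]%SET - 1) P).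
rewrite -[pm_contraction i P]/(slice i (pm_rank P [set i]%SET) P).
set hi := pm_rank _ _ in hiV hhi *; clearbody hi; move=> ehl.
have elo : hi - 1 = lo by rewrite -[1]ehl subKr.
rewrite (slice_expansion i polyP) elo.
have -> : coord_values i P = (lo |` [fset hi])%fset.
  apply/fsetP => t; rewrite !inE; apply/idP/orP => [tV|[/eqP->|/eqP->] //].
  by have := coord_values_bounds hlo hhi tV; lia.
rewrite big_fsetU1 ?big_seq_fset1 /=; last by rewrite inE; lia.
rewrite !(is_min_in loV hlo, is_max_in hiV hhi) // !eqxx.
have -> : (lo == hi) = false by lia.
have -> : (hi == lo) = false by lia.
by congr (_ * _ + _ * _); rewrite /activity_factor /=; ring.
Qed.

End Gap.

(** * The top homogeneous component *)

Section TopDegree.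
Implicit Types p q r : bipoly.

Lemma msize_mul_le p q k l : (msize p <= k.+1)%N -> (msize q <= l)%N ->
  (msize (p * q) <= k + l)%N.
Proof.
move=> hp hq.
have [->|p0] := eqVneq p 0; first by rewrite mul0r msize0.
have [->|q0] := eqVneq q 0; first by rewrite mulr0 msize0.
by rewrite msizeM // -subn1 leq_subLR add1n -addSn leq_add.
Qed.

Lemma msize_add_le p q k : (msize p <= k)%N -> (msize q <= k)%N ->
  (msize (p + q) <= k)%N.
Proof. by move=> hp hq; rewrite (leq_trans (msizeD_le _ _)) // geq_max hp. Qed.

Lemma msize_sum_le (I : Type) (s : seq I) (Q : pred I) (F : I -> bipoly) k :
  (forall i, Q i -> (msize (F i) <= k)%N) ->
  (msize (\sum_(i <- s | Q i) F i) <= k)%N.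
Proof.
move=> h; elim/big_rec: _ => [|i p Qi hp]; first by rewrite msize0.
by apply: msize_add_le; rewrite ?h.
Qed.

Lemma msize_polX : msize polX = 2%N.
Proof. by rewrite /polX msizeX mdeg1. Qed.

Lemma msize_polY : msize polY = 2%N.
Proof. by rewrite /polY msizeX mdeg1. Qed.

Lemma msize_exp_le p k : (msize p <= 2)%N -> (msize (p ^+ k) <= k.+1)%N.
Proof.
move=> hp; elim: k => [|k IH]; first by rewrite expr0 msize1.
by rewrite exprS (leq_trans (msize_mul_le hp IH)).
Qed.

Lemma msize_activity_factor b c : (msize (activity_factor polX polY b c) <= 2)%N.
Proof.
rewrite /activity_factor; do ?apply: msize_add_le; rewrite ?msize1 //.
- case: b; rewrite ?msize0 // mulr1n; apply: msize_add_le.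
    by rewrite msize_polX.
  by rewrite msizeN msize1.
- case: c; rewrite ?msize0 // mulr1n; apply: msize_add_le.
    by rewrite msize_polY.
  by rewrite msizeN msize1.
Qed.

End TopDegree.

Lemma sum_is_min (V : nmodType) n (i : 'I_n.+1) (P : {fset 'rV[int]_n.+1})
    (x : V) (lo : int) : lo \in coord_values i P -> is_min i P lo ->
  \sum_(t <- coord_values i P) x *+ is_min i P t = x.
Proof.
move=> loV hlo; rewrite (big_fsetD1 lo) //= hlo big_seq big1 ?addr0 // => t.
by rewrite !inE => /andP[tlo tV]; rewrite (is_min_in loV) // (negbTE tlo).
Qed.

Lemma sum_is_max (V : nmodType) n (i : 'I_n.+1) (P : {fset 'rV[int]_n.+1})
    (x : V) (hi : int) : hi \in coord_values i P -> is_max i P hi ->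
  \sum_(t <- coord_values i P) x *+ is_max i P t = x.
Proof.
move=> hiV hhi; rewrite (big_fsetD1 hi) //= hhi big_seq big1 ?addr0 // => t.
by rewrite !inE => /andP[thi tV]; rewrite (is_max_in hiV) // (negbTE thi).
Qed.

(** Exactly one slice has the factor x in its linear part and exactly one has
    the factor y, so the factors of the slices sum to x + y plus a constant;
    every slice has top component (x + y)^n by induction. *)
Lemma tutte_top (n : nat) (P : {fset 'rV[int]_n}) : polymatroid P ->
  (msize (tutte_poly P - (polX + polY) ^+ n) <= n)%N.
Proof.
elim: n P => [|n IH] P polyP.
  have -> : P = [fset 0]%fset.
    have /fset0Pn[a aP] := polyP.1.
    by apply/fsetP => b; rewrite inE (thinmx0 b) -(thinmx0 a) aP eqxx.
  rewrite tutte_polyE /ordered_tutte big_seq_fset1 /weight big_ord0 expr0 subrr.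
  by rewrite msize0.
pose i : 'I_n.+1 := ord0.
rewrite (slice_expansion i polyP).
have [lo [loV hlo hiV hhi _]] := pm_gapE i polyP.
set V := coord_values i P in loV hiV *.
pose w t := activity_factor polX polY (is_min i P t) (is_max i P t).
(* The constant terms of the factors 1 + [min] (x - 1) + [max] (y - 1). *)
pose c := \sum_(t <- V) (1 - (is_min i P t)%:R - (is_max i P t)%:R) : bipoly.
have sum_w : \sum_(t <- V) w t = polX + polY + c.
  rewrite -{1}(sum_is_min polX loV hlo) -{1}(sum_is_max polY hiV hhi).
  rewrite /c -!big_split /=; apply: eq_bigr => t _; rewrite /w /activity_factor.
  by rewrite !mulrnBl; ring.
have -> : \sum_(t <- V) w t * tutte_poly (slice i t P) - (polX + polY) ^+ n.+1 =
  \sum_(t <- V) w t * (tutte_poly (slice i t P) - (polX + polY) ^+ n)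
  + c * (polX + polY) ^+ n.
  under [in RHS]eq_bigr do rewrite mulrBr.
  by rewrite sumrB -mulr_suml sum_w exprS; ring.
have sXY : (msize (polX + polY) <= 2)%N.
  by apply: msize_add_le; rewrite ?msize_polX ?msize_polY.
apply: msize_add_le.
- rewrite big_seq; apply: msize_sum_le => t /imfsetP[a /= aP ->].
  have := @msize_mul_le _ _ 1 n (msize_activity_factor _ _) (IH _ (polymatroid_slice i polyP aP)).
  by apply.
- rewrite -[n.+1]add0n; apply: msize_mul_le; last exact: msize_exp_le.
  apply: msize_sum_le => t _; rewrite -!mpolyC_nat -mpolyC1 -!mpolyCB msizeC.
  exact: leq_b1.
Qed.

(** * Coefficients *)

Section Bivariate.
Implicit Types p q : bipoly.

Lemma bicoefD p q k l : bicoef (p + q) k l = bicoef p k l + bicoef q k l.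
Proof. exact: mcoeffD. Qed.

Lemma bicoefXY a b k l :
  bicoef (polX ^+ a * polY ^+ b) k l = ((a == k) && (b == l))%:R.
Proof.
rewrite /bicoef /polX /polY !mpolyXn -mpolyXD mcoeffX; congr (_%:R).
congr nat_of_bool; apply/eqP/andP => [/mnmP e|[/eqP-> /eqP->]].
  have := e ord0; have := e ord_max.
  by rewrite !mnmDE !mulmnE !mnm1E !multinomE !(tnth_nth 0%N) /= => el ek; split; apply/eqP; lia.
apply/mnmP => i; rewrite !mnmDE !mulmnE !mnm1E multinomE.
by case: i => [[|[|//]]] lti; rewrite (tnth_nth 0%N) /=; lia.
Qed.

Lemma mdeg2 k l : mdeg (Multinom [tuple k; l]) = (k + l)%N.
Proof. by rewrite mdegE big_ord_recl big_ord1 !multinomE. Qed.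

Lemma multinom2E (m : multinom 2) :
  m = Multinom [tuple m (ord0 : 'I_2); m (ord_max : 'I_2)].
Proof.
apply/mnmP => i; rewrite !multinomE (tnth_nth 0%N).
by case: i => [[|[|//]]] lti /=; congr (m _); apply: val_inj.
Qed.

Lemma bicoef_binomial k l :
  bicoef ((polX + polY) ^+ (k + l)) k l = 'C(k + l, k)%:R.
Proof.
rewrite exprDn /bicoef raddf_sum /=.
have lt : (l < (k + l).+1)%N by rewrite ltnS leq_addl.
rewrite (bigD1 (Ordinal lt)) //= big1 => [|i].
  rewrite addr0 addnK raddfMn /= -/(bicoef _ k l) bicoefXY !eqxx.
  by rewrite -bin_sub ?leq_addl // addnK.
rewrite -val_eqE /= => il.
by rewrite raddfMn /= -/(bicoef _ k l) bicoefXY (negbTE il) andbF mul0rn.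
Qed.

(** The bound on the size excludes every monomial of total degree k + l, as
    the size is one more than the degree. *)
Lemma bicoef_small p k l : (msize p <= k + l)%N -> bicoef p k l = 0.
Proof. by move=> h; apply: memN_msupp_eq0; rewrite msize_mdeg_ge // mdeg2. Qed.

Definition nonneg_coefs p : Prop := forall m, 0 <= mcoeff m p.

Lemma nonneg_coefsD p q :
  nonneg_coefs p -> nonneg_coefs q -> nonneg_coefs (p + q).
Proof. by move=> hp hq m; rewrite mcoeffD addr_ge0. Qed.

Lemma nonneg_coefsM p q :
  nonneg_coefs p -> nonneg_coefs q -> nonneg_coefs (p * q).
Proof. by move=> hp hq m; rewrite mcoeffM sumr_ge0 // => k _; rewrite mulr_ge0. Qed.

Lemma nonneg_coefs1 : nonneg_coefs 1.
Proof. by move=> m; rewrite mcoeff1; case: eqP. Qed.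

Lemma nonneg_coefsX p k : nonneg_coefs p -> nonneg_coefs (p ^+ k).
Proof.
move=> hp; elim: k => [|k IH]; first exact: nonneg_coefs1.
by rewrite exprS; apply: nonneg_coefsM.
Qed.

Lemma nonneg_polX : nonneg_coefs polX.
Proof. by move=> m; rewrite mcoeffX; case: eqP. Qed.

Lemma nonneg_polY : nonneg_coefs polY.
Proof. by move=> m; rewrite mcoeffX; case: eqP. Qed.

Lemma bisubst_X q r : bisubst polX q r = q.
Proof. by rewrite /bisubst /polX comp_mpolyXU. Qed.

Lemma bisubst_Y q r : bisubst polY q r = r.
Proof. by rewrite /bisubst /polY comp_mpolyXU. Qed.

Lemma bisubst_tutte n (P : {fset 'rV[int]_n}) q r :
  bisubst (tutte_poly P) q r = \sum_(a <- P)
    q ^+ #|(int_active P a :\: ext_active P a)%SET| *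
    r ^+ #|(ext_active P a :\: int_active P a)%SET| *
    (q + r - 1) ^+ #|(int_active P a :&: ext_active P a)%SET|.
Proof.
rewrite /bisubst raddf_sum; apply: eq_bigr => a _.
rewrite /= !rmorphM !rmorphXn /= rmorphB rmorphD rmorph1 /=.
by rewrite ![comp_mpoly _ polX](bisubst_X q r) ![comp_mpoly _ polY](bisubst_Y q r).
Qed.

Lemma bieval_X (s t : int) : bieval polX s t = s.
Proof. by rewrite /bieval /polX mevalXU. Qed.

Lemma bieval_Y (s t : int) : bieval polY s t = t.
Proof. by rewrite /bieval /polY mevalXU. Qed.

Lemma bievalE p (s t : int) : bieval p s t = \sum_(m <- msupp p)
  bicoef p (m (ord0 : 'I_2)) (m (ord_max : 'I_2)) *
  (s ^+ m (ord0 : 'I_2) * t ^+ m (ord_max : 'I_2)).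
Proof.
rewrite /bieval mevalE; apply: eq_bigr => m _.
rewrite /bicoef -multinom2E big_ord_recl big_ord1 !(tnth_nth 0) /=.
by congr (_ * (_ * t ^+ m _)); apply: val_inj.
Qed.

Lemma bieval_tutte n (P : {fset 'rV[int]_n}) (s t : int) :
  bieval (tutte_poly P) s t = \sum_(a <- P)
    s ^+ #|(int_active P a :\: ext_active P a)%SET| *
    t ^+ #|(ext_active P a :\: int_active P a)%SET| *
    (s + t - 1) ^+ #|(int_active P a :&: ext_active P a)%SET|.
Proof.
rewrite /bieval raddf_sum; apply: eq_bigr => a _.
rewrite /= !rmorphM !rmorphXn /= rmorphB rmorphD rmorph1 /=.
by rewrite ![meval _ polX](bieval_X s t) ![meval _ polY](bieval_Y s t).
Qed.

End Bivariate.

Section Degree.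
Variables (n : nat) (P : {fset 'rV[int]_n.+1}).
Hypothesis polyP : polymatroid P.
Let T := tutte_poly P.

Lemma bicoef_tutte_top k : (k <= n.+1)%N ->
  bicoef T k (n.+1 - k) = 'C(n.+1, k)%:R.
Proof.
move=> kn; rewrite -[T](subrK ((polX + polY) ^+ n.+1)) bicoefD.
rewrite bicoef_small ?subnKC ?tutte_top // add0r.
by rewrite -{1}(subnKC kn) bicoef_binomial subnKC.
Qed.

Lemma tutte_degree : has_degree T n.+1.
Proof.
apply/eqP; rewrite eqn_leq; apply/andP; split.
  rewrite -[T](subrK ((polX + polY) ^+ n.+1)); apply: msize_add_le.
    exact/leqW/tutte_top.
  by apply: msize_exp_le; apply: msize_add_le; rewrite ?msize_polX ?msize_polY.
have := bicoef_tutte_top (leq0n _); rewrite subn0 bin0 => h.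
have : Multinom [tuple 0%N; n.+1] \in msupp T.
  by rewrite mcoeff_msupp -/(bicoef _ _ _) h.
by move/msize_mdeg_lt; rewrite mdeg2.
Qed.

Lemma tutte_top_component : top_component T = (polX + polY) ^+ n.+1.
Proof.
rewrite /top_component tutte_degree /= -[T](subrK ((polX + polY) ^+ n.+1)).
rewrite pihomogD.
have -> : pihomog mdeg n.+1 (T - (polX + polY) ^+ n.+1) = 0.
  rewrite pihomogE big_seq_cond big1 // => m /andP[/msize_mdeg_lt + /eqP em].
  by rewrite em ltnNge tutte_top.
rewrite add0r pihomog_dE // -[X in ishomog1 X]mul1n; apply: dhomogMn.
by apply: dhomogD; rewrite dhomogX /= mdeg1.
Qed.

(** The smallest index is active in both ways, which provides the factor
    x + y - 1 of every summand. *)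
Lemma index0_active a : a \in P ->
  ord0 \in (int_active P a :&: ext_active P a)%SET.
Proof.
by move=> aP; rewrite !inE; apply/andP; split; apply/existsPn => j; rewrite ltn0.
Qed.

Lemma tutte_factor : T = (polX + polY - 1) * \sum_(a <- P)
    polX ^+ #|(int_active P a :\: ext_active P a)%SET| *
    polY ^+ #|(ext_active P a :\: int_active P a)%SET| *
    (polX + polY - 1) ^+ #|(int_active P a :&: ext_active P a)%SET|.-1.
Proof.
rewrite mulr_sumr /T /tutte_poly big_seq [RHS]big_seq; apply: eq_bigr => a aP.
rewrite mulrCA -exprS prednK //.
by apply/card_gt0P; exists ord0; apply: index0_active.
Qed.

Lemma tutte_pos_coef : 0 < bicoef T n.+1 0.
Proof. by have := bicoef_tutte_top (leqnn _); rewrite subnn binn => ->. Qed.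

Lemma bieval_tutte_10 : bieval T 1 0 = 0.
Proof.
rewrite bieval_tutte big_seq big1 // => a /index0_active h.
have k0 : (0 < #|(int_active P a :&: ext_active P a)%SET|)%N.
  by apply/card_gt0P; exists ord0.
by rewrite addr0 subrr [X in _ * X]expr0n gtn_eqF // mulr0.
Qed.

(** If no coefficient were negative, the value 0 at (1, 0) would be at least
    the coefficient 1 of the highest power of x. *)
Lemma tutte_neg_coef : exists k l, bicoef T k l < 0.
Proof.
apply: contrapT => /forallNP h.
have {h} pos k l : 0 <= bicoef T k l.
  by rewrite leNgt; apply/negP => lt; apply: (h k); exists l.
have : bicoef T n.+1 0 <= bieval T 1 0.
  rewrite bievalE (bigD1_seq (Multinom [tuple n.+1; 0%N])) ?msupp_uniq //=.
    rewrite !multinomE /= expr1n mul1r expr0 mulr1 lerDl.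
    by apply: sumr_ge0 => m _; rewrite expr1n mul1r mulr_ge0 // exprn_ge0.
  by rewrite mcoeff_msupp -/(bicoef _ _ _) gt_eqF ?tutte_pos_coef.
by rewrite bieval_tutte_10 leNgt tutte_pos_coef.
Qed.

(** The substitution turns the only factor with a negative coefficient,
    x + y - 1, into x + y. *)
Lemma nonneg_tutte_Y1 k l : 0 <= bicoef (bisubst T polX (polY + 1)) k l.
Proof.
rewrite bisubst_tutte /bicoef raddf_sum sumr_ge0 // => a _ /=.
rewrite addrA addrK.
by do ?apply: nonneg_coefsM; apply: nonneg_coefsX; do ?apply: nonneg_coefsD;
  do ?[exact: nonneg_polX | exact: nonneg_polY | exact: nonneg_coefs1].
Qed.

Lemma nonneg_tutte_X1 k l : 0 <= bicoef (bisubst T (polX + 1) polY) k l.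
Proof.
rewrite bisubst_tutte /bicoef raddf_sum sumr_ge0 // => a _ /=.
rewrite addrAC addrK.
by do ?apply: nonneg_coefsM; apply: nonneg_coefsX; do ?apply: nonneg_coefsD;
  do ?[exact: nonneg_polX | exact: nonneg_polY | exact: nonneg_coefs1].
Qed.

End Degree.

(** * Direct sums and aggregated sums *)

Lemma sum_imfset2 (I J K : choiceType) (V : nmodType) (A : {fset I})
    (B : {fset J}) (h : I -> J -> K) (F : K -> V) :
  (forall a a' b b', a \in A -> a' \in A -> b \in B -> b' \in B ->
     h a b = h a' b' -> a = a' /\ b = b') ->
  \sum_(c <- [fset h a b | a in A, b in B]%fset) F c =
  \sum_(a <- A) \sum_(b <- B) F (h a b).
Proof.
move=> inj; rewrite big_imfset2 //= => -[a b] [a' b'] /= /andP[aA bB] /andP[a'A b'B].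
by move/inj => /(_ aA a'A bB b'B)[-> ->].
Qed.

Lemma existsb_split (n m : nat) (R : pred 'I_(n + m)) :
  [exists j, R j] =
  [exists j : 'I_n, R (lshift m j)] || [exists k : 'I_m, R (rshift n k)].
Proof.
apply/existsP/orP => [[j Rj]|[/existsP[j Rj]|/existsP[k Rk]]].
- case: (split_ordP j) Rj => [j' ->|k ->] Rj.
    by left; apply/existsP; exists j'.
  by right; apply/existsP; exists k.
- by exists (lshift m j).
- by exists (rshift n k).
Qed.

Lemma rshift_lt_lshift (n m : nat) (j : 'I_n) (k : 'I_m) :
  (rshift n k < lshift m j)%N = false.
Proof. by apply/negbTE; rewrite -leqNgt /= ltnW // ltn_addr. Qed.

Lemma existsb_none (I : finType) (R : pred I) :
  (forall k, R k = false) -> [exists k, R k] = false.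
Proof. by move=> h; apply/existsP => -[k]; rewrite h. Qed.

Lemma existsb_lift (n : nat) (i : 'I_n.+1) (R : pred 'I_n.+1) :
  [exists j, R j] = R i || [exists k : 'I_n, R (lift i k)].
Proof.
apply/existsP/orP => [[j Rj]|[Ri|/existsP[k Rk]]].
- case: (unliftP i j) Rj => [k ->|->] Rj; last by left.
  by right; apply/existsP; exists k.
- by exists i.
- by exists (lift i k).
Qed.

Lemma evec_lshift (n m : nat) (i : 'I_n) :
  evec int (lshift m i) = row_mx (evec int i) 0.
Proof.
apply/rowP => k; case: (split_ordP k) => j ->;
  rewrite ?row_mxEl ?row_mxEr !mxE eqxx /=.
  by rewrite (inj_eq (@lshift_inj _ _)).
by rewrite eq_rlshift.
Qed.

Lemma evec_rshift (n m : nat) (i : 'I_m) :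
  evec int (rshift n i) = row_mx 0 (evec int i).
Proof.
apply/rowP => k; case: (split_ordP k) => j ->;
  rewrite ?row_mxEl ?row_mxEr !mxE eqxx /=.
  by rewrite eq_lrshift.
by rewrite (inj_eq (@rshift_inj _ _)).
Qed.

Section CoordSum.
Variable n : nat.
Implicit Types a b : 'rV[int]_n.

Lemma coord_sumD a b : coord_sum (a + b) = coord_sum a + coord_sum b.
Proof. by rewrite /coord_sum -big_split; apply: eq_bigr => k _; rewrite mxE. Qed.

Lemma coord_sumB a b : coord_sum (a - b) = coord_sum a - coord_sum b.
Proof. by rewrite /coord_sum -sumrB; apply: eq_bigr => k _; rewrite !mxE. Qed.

Lemma coord_sum_evec i : coord_sum (evec int i : 'rV_n) = 1.
Proof. exact: (@sum_evec int n predT i). Qed.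

End CoordSum.

(** An edge between the two blocks would change the coordinate sum of each
    block, which is constant, so all edges of a direct sum lie in one block. *)
Section DirectSum.
Variables (n m : nat) (P : {fset 'rV[int]_n}) (Q : {fset 'rV[int]_m}).
Hypotheses (polyP : polymatroid P) (polyQ : polymatroid Q).

Lemma mem_direct_sum u v :
  (row_mx u v \in direct_sum P Q) = (u \in P) && (v \in Q).
Proof.
apply/imfset2P/andP => [[a /= aP [b /= bQ /eq_row_mx[-> ->]]] //|[uP vQ]].
by exists u => //; exists v.
Qed.

Let not_shifted a j : a \in P -> (a + evec int j \in P) = false.
Proof.
move=> aP; apply/negP => /(coord_sum_const polyP aP).
by rewrite coord_sumD coord_sum_evec; lia.
Qed.

Let not_shifted' a j : a \in P -> (a - evec int j \in P) = false.
Proof.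
move=> aP; apply/negP => /(coord_sum_const polyP aP).
by rewrite coord_sumB coord_sum_evec; lia.
Qed.

Section At.
Variables (a : 'rV[int]_n) (b : 'rV[int]_m).
Hypotheses (aP : a \in P) (bQ : b \in Q).

Let edge_ll i j :
  edge (direct_sum P Q) (row_mx a b) (lshift m i) (lshift m j) = edge P a i j.
Proof.
rewrite /edge !evec_lshift opp_row_mx !add_row_mx mem_direct_sum.
by rewrite oppr0 !addr0 bQ andbT.
Qed.

Let edge_rr i j :
  edge (direct_sum P Q) (row_mx a b) (rshift n i) (rshift n j) = edge Q b i j.
Proof.
rewrite /edge !evec_rshift opp_row_mx !add_row_mx mem_direct_sum.
by rewrite oppr0 !addr0 aP.
Qed.

Let edge_lr i j :
  edge (direct_sum P Q) (row_mx a b) (lshift m i) (rshift n j) = false.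
Proof.
rewrite /edge evec_lshift evec_rshift opp_row_mx !add_row_mx mem_direct_sum.
by rewrite addr0 not_shifted'.
Qed.

Let edge_rl i j :
  edge (direct_sum P Q) (row_mx a b) (rshift n i) (lshift m j) = false.
Proof.
rewrite /edge evec_lshift evec_rshift opp_row_mx !add_row_mx mem_direct_sum.
by rewrite oppr0 addr0 not_shifted.
Qed.

Lemma weight_direct_sum :
  weight (@nat_of_ord _) (direct_sum P Q) (row_mx a b) =
  weight (@nat_of_ord _) P a * weight (@nat_of_ord _) Q b.
Proof.
rewrite /weight big_split_ord /=; congr (_ * _);
  apply: eq_bigr => l _; congr (activity_factor _ _ (~~ _) (~~ _)).
- rewrite /loses existsb_split.
  rewrite [X in _ || X]existsb_none ?orbF => [|k]; last by rewrite edge_lr andbF.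
  by apply: eq_existsb => j; rewrite edge_ll.
- rewrite /gains existsb_split.
  rewrite [X in _ || X]existsb_none ?orbF => [|k]; last by rewrite edge_rl andbF.
  by apply: eq_existsb => j; rewrite edge_ll.
- rewrite /loses existsb_split.
  rewrite [X in X || _]existsb_none /= => [|k]; last by rewrite edge_rl andbF.
  by apply: eq_existsb => j; rewrite edge_rr ltn_add2l.
- rewrite /gains existsb_split.
  rewrite [X in X || _]existsb_none /= => [|k]; last by rewrite edge_lr andbF.
  by apply: eq_existsb => j; rewrite edge_rr ltn_add2l.
Qed.

End At.

Lemma tutte_direct_sum :
  tutte_poly (direct_sum P Q) = tutte_poly P * tutte_poly Q.
Proof.
rewrite !tutte_polyE /ordered_tutte sum_imfset2; last first.
  by move=> a a' b b' _ _ _ _ /eq_row_mx[].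
rewrite mulr_suml big_seq [RHS]big_seq; apply: eq_bigr => a aP.
rewrite mulr_sumr big_seq [RHS]big_seq; apply: eq_bigr => b bQ.
exact: weight_direct_sum.
Qed.

End DirectSum.

Section AggregatedSum.
Variables (n m : nat) (P : {fset 'rV[int]_n.+1}) (Q : {fset 'rV[int]_m.+1}).
Hypotheses (polyP : polymatroid P) (polyQ : polymatroid Q).
Let e0 : 'rV[int]_n.+1 := evec int ord0.

Lemma insert_coord_sum (t : int) (v : 'rV[int]_m) :
  coord_sum (insert ord0 t v) = t + coord_sum v.
Proof.
rewrite /coord_sum big_ord_recl insert_at; congr (_ + _).
by apply: eq_bigr => k _; rewrite insert_lift.
Qed.

(** The way in which the shared coordinate splits is determined by the other
    coordinates of the second block: t is what they lack to the constant
    coordinate sum of Q. *)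
Lemma mem_aggregated_sum (b : 'rV[int]_m.+1) (t : int) u (v : 'rV[int]_m) :
  b \in Q -> coord_sum b = t + coord_sum v ->
  (row_mx (u + t *: e0) v \in aggregated_sum P Q) =
  (u \in P) && (insert ord0 t v \in Q).
Proof.
move=> bQ sb; apply/imfset2P/andP => [[a /= aP [b' /= b'Q]]|[uP vQ]].
  move/eq_row_mx => [eu ev].
  have et : t = b' 0 ord0.
    have := coord_sum_const polyQ bQ b'Q; rewrite sb ev.
    rewrite -{2}(insert_col' ord0 b') insert_coord_sum; exact: addIr.
  rewrite ev et insert_col' b'Q; move: eu; rewrite et => /addIr ->.
  by rewrite aP.
exists u => //; exists (insert ord0 t v) => //.
by rewrite /aggregate insert_at col'_insert.
Qed.

Section At.
Variables (a : 'rV[int]_n.+1) (b : 'rV[int]_m.+1).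
Hypotheses (aP : a \in P) (bQ : b \in Q).
Let c := aggregate a b.

Let sum_b : coord_sum b = b 0 ord0 + coord_sum (col' ord0 b : 'rV_m).
Proof. by rewrite -{1}(insert_col' ord0 b) insert_coord_sum. Qed.

Let edge_ll i j :
  edge (aggregated_sum P Q) c (lshift m i) (lshift m j) = edge P a i j.
Proof.
rewrite /edge !evec_lshift /c /aggregate opp_row_mx !add_row_mx oppr0 !addr0.
have -> : a + b 0 ord0 *: evec int ord0 - evec int i + evec int j =
  (a - evec int i + evec int j) + b 0 ord0 *: e0.
  by rewrite -!addrA; congr (_ + _); rewrite addrC addrA.
by rewrite (mem_aggregated_sum _ bQ sum_b) insert_col' bQ andbT.
Qed.

Let coord_sum_move (v : 'rV[int]_m) k l :
  coord_sum (v - evec int k + evec int l) = coord_sum v.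
Proof. by rewrite coord_sumD coord_sumB !coord_sum_evec subrK. Qed.

Let edge_rr k l : edge (aggregated_sum P Q) c (rshift n.+1 k) (rshift n.+1 l) =
  edge Q b (lift ord0 k) (lift ord0 l).
Proof.
rewrite /edge !evec_rshift /c /aggregate opp_row_mx !add_row_mx oppr0 !addr0.
rewrite (mem_aggregated_sum _ bQ) ?aP ?coord_sum_move //=.
by rewrite -mem_slice -/(edge _ _ _ _) edge_slice insert_col'.
Qed.

Let edge_rl k j : edge (aggregated_sum P Q) c (rshift n.+1 k) (lshift m j) =
  edge P a ord0 j && edge Q b (lift ord0 k) ord0.
Proof.
rewrite /edge evec_rshift evec_lshift /c /aggregate opp_row_mx !add_row_mx.
rewrite oppr0 !addr0.
have -> : a + b 0 ord0 *: evec int ord0 + evec int j =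
  (a - e0 + evec int j) + (b 0 ord0 + 1) *: e0.
  by rewrite /e0; row_entries.
rewrite (mem_aggregated_sum _ bQ); last first.
  by rewrite coord_sumB coord_sum_evec sum_b; ring.
congr (_ && (_ \in Q)); apply/rowP => l.
case: (unliftP ord0 l) => [l' ->|->].
  by rewrite insert_lift !mxE (inj_eq lift_inj) /=; ring.
by rewrite insert_at !mxE !eqxx /=; ring.
Qed.

Let edge_lr j k : edge (aggregated_sum P Q) c (lshift m j) (rshift n.+1 k) =
  edge P a j ord0 && edge Q b ord0 (lift ord0 k).
Proof.
rewrite /edge evec_rshift evec_lshift /c /aggregate opp_row_mx !add_row_mx.
rewrite oppr0 !addr0.
have -> : a + b 0 ord0 *: evec int ord0 - evec int j =
  (a - evec int j + e0) + (b 0 ord0 - 1) *: e0.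
  by rewrite /e0; row_entries.
rewrite (mem_aggregated_sum _ bQ); last first.
  by rewrite coord_sumD coord_sum_evec sum_b; ring.
congr (_ && (_ \in Q)); apply/rowP => l.
case: (unliftP ord0 l) => [l' ->|->].
  by rewrite insert_lift !mxE (inj_eq lift_inj) /=; ring.
by rewrite insert_at !mxE !eqxx /=; ring.
Qed.

(** An edge from an index l of the second block to the first block goes to the
    shared index in Q and continues from there in P; the shared index itself is
    always a possible target in P.  So l has an edge to a smaller index of the
    aggregated sum iff it has one in Q, and likewise for edges in the other
    direction.  The factor on the left accounts for the shared index, which
    contributes x + y - 1 to both factors on the right but only once on the
    left. *)
Lemma weight_aggregate :
  (polX + polY - 1) * weight (@nat_of_ord _) (aggregated_sum P Q) c =
  weight (@nat_of_ord _) P a * weight (@nat_of_ord _) Q b.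
Proof.
have factor0 : activity_factor polX polY
    (~~ loses (@nat_of_ord _) Q b ord0) (~~ gains (@nat_of_ord _) Q b ord0) =
  polX + polY - 1.
  rewrite /loses /gains !existsb_none //.
  by rewrite /activity_factor /=; ring.
rewrite /weight big_split_ord [X in _ = _ * X]big_ord_recl factor0.
rewrite mulrCA; congr (_ * (_ * _)); apply: eq_bigr => l _;
  congr (activity_factor _ _ (~~ _) (~~ _)).
- rewrite /loses existsb_split.
  rewrite [X in _ || X]existsb_none ?orbF => [|k]; last first.
    by rewrite rshift_lt_lshift.
  by apply: eq_existsb => j; rewrite edge_ll.
- rewrite /gains existsb_split.
  rewrite [X in _ || X]existsb_none ?orbF => [|k]; last first.
    by rewrite rshift_lt_lshift.
  by apply: eq_existsb => j; rewrite edge_ll.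
- rewrite /loses existsb_split (existsb_lift ord0).
  congr (_ || _); last by apply: eq_existsb => k; rewrite edge_rr ltn_add2l.
  apply/existsP/idP => [[j]|/= e]; first by rewrite edge_rl => /and3P[].
  by exists ord0; rewrite edge_rl edge_self aP e ltn_addr.
- rewrite /gains existsb_split (existsb_lift ord0).
  congr (_ || _); last by apply: eq_existsb => k; rewrite edge_rr ltn_add2l.
  apply/existsP/idP => [[j]|/= e]; first by rewrite edge_lr => /and3P[].
  by exists ord0; rewrite edge_lr edge_self aP e ltn_addr.
Qed.

End At.

Lemma tutte_aggregated_sum :
  (polX + polY - 1) * tutte_poly (aggregated_sum P Q) =
  tutte_poly P * tutte_poly Q.
Proof.
rewrite !tutte_polyE /ordered_tutte sum_imfset2; last first.
  move=> a a' b b' aP a'P bQ b'Q /eq_row_mx[ea eb].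
  have eb0 : b 0 ord0 = b' 0 ord0.
    have := coord_sum_const polyQ bQ b'Q.
    rewrite -{1}(insert_col' ord0 b) -{1}(insert_col' ord0 b') eb.
    by rewrite !insert_coord_sum => /addIr.
  split; first by move: ea; rewrite eb0 => /addIr.
  by rewrite -(insert_col' ord0 b) -(insert_col' ord0 b') eb eb0.
rewrite mulr_suml mulr_sumr big_seq [RHS]big_seq; apply: eq_bigr => a aP.
rewrite !mulr_sumr big_seq [RHS]big_seq; apply: eq_bigr => b bQ.
exact: weight_aggregate.
Qed.

End AggregatedSum.

(** * Convex and affine hulls *)

Section Hulls.
Variables (R : realType) (n : nat).
Implicit Types (S : set 'rV[R]_n) (x y q : 'rV[R]_n).

Lemma sum_star (m : nat) q (p : 'I_m -> 'rV[R]_n) (w : 'I_m -> R) :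
  q + \sum_k w k *: (p k - q) =
  (1 - \sum_k w k) *: q + \sum_k w k *: p k.
Proof.
under eq_bigr do rewrite scalerBr.
by rewrite sumrB -scaler_suml scalerBl scale1r addrA addrAC.
Qed.

(** Combinations based at a point q of S need no condition on the sum of the
    weights, as q absorbs the difference to 1. *)
Lemma affine_hull_star S (m : nat) q (p : 'I_m -> 'rV[R]_n) (w : 'I_m -> R) :
  S q -> (forall k, S (p k)) ->
  affine_hull S (q + \sum_k w k *: (p k - q)).
Proof.
move=> Sq Sp; exists m.+1, (fun i => oapp p q (unlift ord0 i)).
exists (fun i => oapp w (1 - \sum_k w k) (unlift ord0 i)); split.
- by move=> i; case: unliftP => //=.
- rewrite big_ord_recl unlift_none -[RHS](subrK (\sum_k w k)); congr (_ + _).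
  by apply: eq_bigr => k _; rewrite liftK.
- rewrite sum_star big_ord_recl !unlift_none; congr (_ + _).
  by apply: eq_bigr => k _; rewrite !liftK.
Qed.

Lemma convex_hull_star S (m : nat) q (p : 'I_m -> 'rV[R]_n) (w : 'I_m -> R) :
  S q -> (forall k, S (p k)) -> (forall k, 0 <= w k) -> \sum_k w k <= 1 ->
  convex_hull S (q + \sum_k w k *: (p k - q)).
Proof.
move=> Sq Sp w0 w1; exists m.+1, (fun i => oapp p q (unlift ord0 i)).
exists (fun i => oapp w (1 - \sum_k w k) (unlift ord0 i)); split.
- by move=> i; case: unliftP => //=.
- by move=> i; case: unliftP => //= _; rewrite subr_ge0.
- rewrite big_ord_recl unlift_none -[RHS](subrK (\sum_k w k)); congr (_ + _).
  by apply: eq_bigr => k _; rewrite liftK.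
- rewrite sum_star big_ord_recl !unlift_none; congr (_ + _).
  by apply: eq_bigr => k _; rewrite !liftK.
Qed.

Lemma sub_convex_hull S : S `<=` convex_hull S.
Proof.
move=> x Sx; exists 1%N, (fun=> x), (fun=> 1); split=> //.
- by rewrite big_ord1.
- by rewrite big_ord1 scale1r.
Qed.

Lemma convex_sub_affine S : convex_hull S `<=` affine_hull S.
Proof. by move=> x [k [p [w [Sp _ w1 ->]]]]; exists k, p, w. Qed.

Lemma affine_hull_sub (V : {vspace 'rV[R]_n}) S q :
  (forall x, S x -> x - q \in V) -> forall x, affine_hull S x -> x - q \in V.
Proof.
move=> h x [k [p [w [Sp w1 ->]]]].
have -> : \sum_i w i *: p i - q = \sum_i w i *: (p i - q).
  under [in RHS]eq_bigr do rewrite scalerBr.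
  by rewrite sumrB -scaler_suml w1 scale1r.
by apply: memv_suml => i _; apply/memvZ/h.
Qed.

Lemma sum_combination (U : pred 'I_n) (m : nat) (p : 'I_m -> 'rV[R]_n)
    (w : 'I_m -> R) :
  \sum_(j | U j) (\sum_i w i *: p i) 0 j =
  \sum_i w i * \sum_(j | U j) p i 0 j.
Proof.
under eq_bigr do rewrite summxE.
rewrite exchange_big; apply: eq_bigr => i _; rewrite mulr_sumr.
by apply: eq_bigr => j _; rewrite mxE.
Qed.

Lemma convex_hull_ge (U : pred 'I_n) (s : R) S :
  (forall x, S x -> s <= \sum_(k | U k) x 0 k) ->
  forall x, convex_hull S x -> s <= \sum_(k | U k) x 0 k.
Proof.
move=> h x [k [p [w [Sp w0 w1 ->]]]]; rewrite sum_combination.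
rewrite -[s]mul1r -w1 mulr_suml; apply: ler_sum => i _.
by rewrite ler_wpM2l // h.
Qed.

Lemma affine_hull_eq (U : pred 'I_n) (s : R) S :
  (forall x, S x -> \sum_(k | U k) x 0 k = s) ->
  forall x, affine_hull S x -> \sum_(k | U k) x 0 k = s.
Proof.
move=> h x [k [p [w [Sp w1 ->]]]]; rewrite sum_combination.
rewrite -[RHS]mul1r -w1 mulr_suml; apply: eq_bigr => i _.
by rewrite h.
Qed.

End Hulls.

Section RealVector.
Variables (R : realType) (n : nat).
Local Notation rv := (@real_vector R n).

Lemma real_vectorD a b : rv (a + b) = rv a + rv b.
Proof. exact: map_mxD. Qed.

Lemma real_vectorB a b : rv (a - b) = rv a - rv b.
Proof. exact: map_mxB. Qed.

Lemma real_vector_evec i : rv (evec int i) = evec R i.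
Proof. exact: map_delta_mx. Qed.

Lemma real_vector_inj : injective rv.
Proof.
by move=> a b /rowP e; apply/rowP => k; apply: (@intr_inj R); have := e k; rewrite !mxE.
Qed.

Lemma sum_real_vector (U : pred 'I_n) a :
  \sum_(k | U k) rv a 0 k = (\sum_(k | U k) a 0 k)%:~R.
Proof. by rewrite rmorph_sum /=; apply: eq_bigr => k _; rewrite mxE. Qed.

Lemma real_vector_edge a i j :
  rv (a - evec int i + evec int j) - rv a = evec R j - evec R i.
Proof.
rewrite real_vectorD real_vectorB !real_vector_evec.
by rewrite addrC !addrA addNr add0r addrC.
Qed.

Lemma has_card_real_vector (S : set 'rV[R]_n) (F : {fset 'rV[int]_n}) :
  (forall x, S x <-> exists2 a, a \in F & x = rv a) -> has_card S #|` F|.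
Proof.
move=> SE; have -> : S = rv @` [set` F].
  by apply/seteqP; split => x; rewrite SE => -[a aF]; exists a.
split; first exact/finite_image/finite_fset.
rewrite fset_set_image // set_fsetK card_imfset //; exact: real_vector_inj.
Qed.

Lemma polytope_real_vector (P : {fset 'rV[int]_n}) a : a \in P -> polytope P (rv a).
Proof. by move=> aP; apply: sub_convex_hull; exists a. Qed.

Section Polytope.
Variable P : {fset 'rV[int]_n}.
Hypothesis polyP : polymatroid P.

Lemma closed_set_polytope (U : pred 'I_n) a : a \in P ->
  (forall i j, edge P a i j -> U i -> U j) ->
  forall x, polytope P x -> \sum_(k | U k) rv a 0 k <= \sum_(k | U k) x 0 k.
Proof.
move=> aP clU; apply: convex_hull_ge => _ [b /= bP <-].
by rewrite !sum_real_vector ler_int (closed_set_minimal polyP aP).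
Qed.

(** Let b be a point of P closest to c.  If b had a coordinate larger than c,
    the set U of indices reached by edges at b from such coordinates would be
    closed under edges; by the choice of b it contains no index with b_u < c_u,
    so the sum over U would be smaller at c than at b.  Otherwise b <= c, and
    the equal coordinate sums give b = c. *)
Lemma polytope_integer c : polytope P (rv c) -> c \in P.
Proof.
move=> cP; have /fset0Pn[a0 a0P] := polyP.1.
have exb : exists d, has (fun b => dist b c == d) P.
  by exists (dist a0 c); apply/hasP; exists a0.
have [_ /hasP[b bP /eqP <-] bmin] := ex_minnP exb.
have {}bmin b' : b' \in P -> (dist b c <= dist b' c)%N.
  by move=> b'P; apply: bmin; apply/hasP; exists b'.
have sbc : coord_sum b = coord_sum c.
  apply: (@intr_inj R); rewrite -!(sum_real_vector predT).
  apply/esym; apply: (affine_hull_eq _ (convex_sub_affine cP)) => _ [b' /= b'P <-].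
  by rewrite !sum_real_vector; congr (_%:~R); apply: (coord_sum_const polyP).
case: (boolP [forall i, b 0 i <= c 0 i]) => [/forallP bc|].
  suff -> : c = b by [].
  apply/rowP => i; apply/eqP; rewrite -subr_eq0.
  have h : \sum_i (c 0 i - b 0 i) = 0.
    by rewrite sumrB; apply/eqP; rewrite subr_eq0; apply/eqP.
  have ge0 k : true -> 0 <= c 0 k - b 0 k by rewrite subr_ge0 bc.
  by rewrite (psumr_eq0P ge0 h).
rewrite negb_forall => /existsP[i]; rewrite -ltNge => bi.
pose U u := [exists k, (c 0 k < b 0 k) && edge P b k u].
have clU u v : edge P b u v -> U u -> U v.
  move=> euv /existsP[k /andP[bk eku]]; apply/existsP; exists k; rewrite bk /=.
  exact: edge_trans euv.
have := closed_set_polytope bP clU cP; rewrite !sum_real_vector ler_int.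
rewrite leNgt => /negP[]; have Ui : U i.
  by apply/existsP; exists i; rewrite bi edge_self.
rewrite (bigD1 i) //= [ltRHS](bigD1 i) //=; apply: ltr_leD => //.
apply: ler_sum => u /andP[/existsP[k /andP[bk eku]] _].
rewrite leNgt; apply/negP => bu.
(* The edge from k to u would lead from b to a point closer to c. *)
by have := bmin _ eku; rewrite leqNgt dist_exchange.
Qed.

End Polytope.
End RealVector.

(** * Direction space and relative interior *)

Section Direction.
Variables (R : realType) (n : nat) (P : {fset 'rV[int]_n}).
Hypothesis polyP : polymatroid P.
Local Notation rv := (@real_vector R n).
Local Notation cP := (@polytope R n P).

Definition difference_span (a : 'rV[int]_n) : {vspace 'rV[R]_n} :=
  <<[seq rv b - rv a | b <- P]>>%VS.

Lemma mem_difference_span a b : b \in P -> rv b - rv a \in difference_span a.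
Proof. by move=> bP; apply: memv_span; apply/mapP; exists b. Qed.

Lemma affine_hull_polytope a x : affine_hull cP x -> x - rv a \in difference_span a.
Proof.
apply: affine_hull_sub => y /convex_sub_affine; apply: affine_hull_sub.
by move=> _ [b /= bP <-]; apply: mem_difference_span.
Qed.

Lemma affine_hull_point a : a \in P -> affine_hull cP (rv a).
Proof.
by move=> aP; apply/convex_sub_affine/sub_convex_hull/polytope_real_vector.
Qed.

Lemma affine_hull_polytopeP a x : a \in P ->
  affine_hull cP x <-> x - rv a \in difference_span a.
Proof.
move=> aP; split; first exact: affine_hull_polytope.
rewrite /difference_span; set s := [seq _ | _ <- _].
move/(@coord_span _ _ _ (in_tuple s)) => xE.
rewrite -[x](subrK (rv a)) addrC xE.
have nthE (k : 'I_(size s)) :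
    exists2 b, b \in P & (in_tuple s)`_k = rv b - rv a.
  by have /mapP[b bP e] := mem_nth 0 (ltn_ord k); exists b.
pose p k := (in_tuple s)`_k + rv a.
under eq_bigr => k _ do rewrite -[(in_tuple s)`_k](addrK (rv a)).
apply: (@affine_hull_star _ _ _ _ _ p).
- exact: polytope_real_vector.
- by move=> k; rewrite /p; have [b bP ->] := nthE k; rewrite subrK; apply: polytope_real_vector.
Qed.

Lemma directionE a : a \in P -> direction cP = difference_span a.
Proof.
move=> aP.
have spanE : [set` difference_span a] =
    [set x - y | x in affine_hull cP & y in affine_hull cP].
  apply/seteqP; split => [v /= vV|_ [x Ax [y Ay <-]]] /=.
    exists (v + rv a); first by apply/(affine_hull_polytopeP _ aP); rewrite addrK.
    by exists (rv a); [apply: affine_hull_point | rewrite addrK].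
  rewrite -[x](subrK (rv a)) -addrA -[_ - y]opprB.
  by apply: memvB; apply: affine_hull_polytope.
apply: xget_unique => //= W; rewrite -spanE => WE.
by apply/vspaceP => v; apply/idP/idP => h;
  [have : [set` W] v by [] | have : [set` difference_span a] v by []];
  rewrite ?WE // -WE.
Qed.

Lemma mem_direction_edge a i j : a \in P -> edge P a i j ->
  evec R j - evec R i \in direction cP.
Proof.
move=> aP e; rewrite (directionE aP) -(real_vector_edge R a).
exact: mem_difference_span.
Qed.

Lemma dim_row : \dim {: 'rV[R]_n} = n.
Proof. by rewrite dimvf /dim /= mul1n. Qed.

(** By induction, each e_i lies in the sum of the direction space and the span
    of the e_k with k active in both ways: any other i is joined by an edge to
    some j < i, and e_i - e_j is a direction. *)
Lemma codim_le_active a : a \in P ->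
  (affine_codim cP <= #|(int_active P a :&: ext_active P a)%SET|)%N.
Proof.
move=> aP; pose I0 := (int_active P a :&: ext_active P a)%SET.
pose W : {vspace 'rV[R]_n} := <<[seq evec R i | i <- enum I0]>>%VS.
have dimW : (\dim W <= #|I0|)%N.
  by rewrite (leq_trans (dim_span _)) // size_map cardE.
rewrite /affine_codim leq_subLR (leq_trans _ (leq_add (leqnn _) dimW)) //.
rewrite /affine_dim -{1}dim_row (leq_trans _ (dimv_add_leqif _ _)) //.
suff eVW i : evec R i \in (direction cP + W)%VS.
  apply/dimvS/subvP => v _; rewrite [v]row_sum_delta.
  by apply: memv_suml => i _; exact/memvZ/eVW.
have [m] := ubnP (i : nat); elim: m i => // m IH i im.
case: (boolP (i \in I0)) => [iI0|].
  apply: (subvP (addvSr _ _)); apply/memv_span/mapP; exists i => //.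
  by rewrite mem_enum.
have step (j : 'I_n) : (j < i)%N -> edge P a i j || edge P a j i ->
    evec R i \in (direction cP + W)%VS.
  move=> ji e; rewrite -[evec R i](subrK (evec R j)); apply: memvD.
    apply: (subvP (addvSl _ _)); case/orP: e => e.
      by rewrite -opprB memvN; apply: mem_direction_edge e.
    exact: mem_direction_edge e.
  by apply: IH; rewrite (leq_trans ji).
rewrite inE int_activeE ext_activeE negb_and !negbK.
by case/orP=> /existsP[j /andP[ji e]]; apply: (step j); rewrite // e ?orbT.
Qed.

Definition reversible (a : 'rV[int]_n) : Prop :=
  forall i j, edge P a i j -> edge P a j i.

Lemma reversible_active a : reversible a -> int_active P a = ext_active P a.
Proof.
move=> rev; apply/setP => i; rewrite int_activeE ext_activeE; congr (~~ _).
by apply/existsP/existsP => -[j /andP[ji /rev e]]; exists j; rewrite ji.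
Qed.

(** Induction on a bound for the indices.  Let i < j and let i -> j be an edge.
    Then j is not externally active, hence not internally active, so there is
    an edge j -> k with k < j.  The composite i -> k is reversible by
    induction, and j -> k -> i is the edge wanted. *)
Lemma active_reversible a : int_active P a = ext_active P a -> reversible a.
Proof.
move=> eqIE.
have lgE i : loses (@nat_of_ord n) P a i = gains (@nat_of_ord n) P a i.
  by apply: negb_inj; rewrite -int_activeE eqIE ext_activeE.
suff rev m (i j : 'I_n) : (i < m)%N -> (j < m)%N -> edge P a i j -> edge P a j i.
  by move=> i j; apply: (rev n).
elim: m i j => // m IH i j im jm e.
have tr := @edge_trans _ _ polyP a.
have [ltij|ltji|/val_inj eij] := ltngtP i j; last by rewrite eij in e *.
- have {}im : (i < m)%N := leq_trans ltij jm.
  have : loses (@nat_of_ord n) P a j.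
    by rewrite lgE; apply/existsP; exists i; rewrite ltij.
  case/existsP=> k /andP[kj ejk]; apply: (tr _ _ _ ejk); apply: IH => //.
    exact: leq_trans kj jm.
  exact: (tr _ _ _ e ejk).
- have {}jm : (j < m)%N := leq_trans ltji im.
  have : gains (@nat_of_ord n) P a i.
    by rewrite -lgE; apply/existsP; exists j; rewrite ltji.
  case/existsP=> k /andP[ki eki]; apply: (tr _ _ _ _ eki); apply: IH => //.
    exact: leq_trans ki im.
  exact: (tr _ _ _ eki e).
Qed.

(** At a point where edges are reversible they form an equivalence relation,
    and the active indices are the smallest elements of its classes.  The
    vectors e_k - e_m, with m the minimum of the class of k, are directions
    both of whose signs stay in P; they span the direction space, and the
    coordinate along the k-th of them is just the k-th coordinate. *)
Section Reversible.
Variable a : 'rV[int]_n.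
Hypotheses (aP : a \in P) (rev : reversible a).

Definition class_min (k : 'I_n) : 'I_n := [arg min_(j < k | edge P a k j) j].

Lemma class_min_edge k : edge P a k (class_min k).
Proof. by rewrite /class_min; case: arg_minnP; rewrite ?edge_self. Qed.

Lemma class_min_le k j : edge P a k j -> (class_min k <= j)%N.
Proof.
rewrite /class_min; case: arg_minnP; rewrite ?edge_self // => i _ h.
exact: h.
Qed.

Lemma edge_class_min i j : edge P a i j -> class_min i = class_min j.
Proof.
move=> e; apply: val_inj; apply/eqP; rewrite eqn_leq /=; apply/andP; split.
  exact/class_min_le/(edge_trans polyP e)/class_min_edge.
exact/class_min_le/(edge_trans polyP (rev e))/class_min_edge.
Qed.

Lemma class_min_active k : k \in int_active P a -> class_min k = k.
Proof.
rewrite int_activeE => /existsPn/(_ (class_min k)).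
rewrite class_min_edge andbT -leqNgt => h; apply: val_inj; apply/eqP.
by rewrite eqn_leq h class_min_le ?edge_self.
Qed.

(* Multiplication by M moves the coordinate of each index to the minimum of its
   class, that is, it computes the sums over the classes. *)
Let M : 'M[R]_n := \matrix_k evec R (class_min k).

Let evecM k : evec R k *m M = evec R (class_min k).
Proof. by rewrite -rowE rowK. Qed.

Lemma class_sums_zero z : z \in difference_span a -> z *m M = 0.
Proof.
suff h b : b \in P -> (rv b - rv a) *m M = 0.
  rewrite /difference_span; set s := [seq _ | _ <- _].
  move/(@coord_span _ _ _ (in_tuple s)) => ->; rewrite mulmx_suml big1 // => k _.
  have /mapP[b bP e] := mem_nth 0 (ltn_ord k : (k < size (in_tuple s))%N).
  by rewrite e -scalemxAl h ?scaler0.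
move: b; apply: (exchange_connected polyP aP); first by rewrite subrr mul0mx.
move=> b i j e; rewrite real_vectorD real_vectorB !real_vector_evec !mulmxBl.
rewrite mulmxDl mulmxBl !evecM (edge_class_min e) => <-.
by rewrite subrK.
Qed.

Lemma span_star z : z \in difference_span a ->
  z = \sum_k z 0 k *: (evec R k - evec R (class_min k)).
Proof.
move=> zV; under eq_bigr do rewrite scalerBr.
rewrite sumrB -row_sum_delta.
have <- : z *m M = \sum_k z 0 k *: evec R (class_min k).
  by rewrite mulmx_sum_row; apply: eq_bigr => k _; rewrite rowK.
by rewrite class_sums_zero // subr0.
Qed.

Lemma codim_reversible : affine_codim cP = #|int_active P a|.
Proof.
apply/eqP; rewrite eqn_leq; apply/andP; split.
  by have := codim_le_active aP; rewrite -(reversible_active rev) finset.setIid.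
rewrite /affine_codim /affine_dim (directionE aP).
pose W : {vspace 'rV[R]_n} := <<[seq evec R k - evec R (class_min k) |
  k <- enum (~: int_active P a)%SET]>>%VS.
have VW : (difference_span a <= W)%VS.
  apply/subvP => z /span_star ->; apply: memv_suml => k _; apply: memvZ.
  case: (boolP (k \in int_active P a)) => kI.
    by rewrite class_min_active // subrr mem0v.
  by apply/memv_span/mapP; exists k; rewrite // mem_enum inE.
have dimV : (\dim (difference_span a) <= #|~: int_active P a|%SET)%N.
  rewrite (leq_trans (dimvS VW)) // (leq_trans (dim_span _)) //.
  by rewrite size_map cardE.
have := cardsC (int_active P a); rewrite card_ord; lia.
Qed.

End Reversible.

(** The relative interior in terms of coordinates: the uniform structure on
    row vectors is given by the maximum of the coordinates. *)
Lemma relative_interiorP x : affine_hull cP x ->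
  relative_interior cP x <->
  exists2 e : R, 0 < e & forall y, affine_hull cP y ->
    (forall k, `|x 0 k - y 0 k| < e) -> cP y.
Proof.
move=> Ax; have <- : within (affine_hull cP) (nbhs x) cP = relative_interior cP x.
  by rewrite (nbhs_subspace_in Ax).
rewrite /within /=; split=> [/nbhs_ballP[e e0 h]|[e e0 h]].
  exists e => // y Ay xy; apply: h => //; split=> // i k.
  by rewrite ord1; apply: xy.
apply/nbhs_ballP; exists e => // y [_ xy] Ay; apply: h => // k.
exact: xy.
Qed.

(** If the edge i -> j cannot be reversed, then the set U of indices reached
    from j does not contain i, and its coordinate sum is minimal at a; a small
    step from a in the direction e_i - e_j decreases it, so it leaves the
    polytope.  If all edges are reversible, a nearby point of the affine hull
    is a plus a combination of the vectors e_k - e_m with small coefficients,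
    and both signs of these vectors are exchanges inside P. *)
Lemma relint_reversible a : a \in P -> relative_interior cP (rv a) <-> reversible a.
Proof.
move=> aP; rewrite (relative_interiorP (affine_hull_point aP)).
split=> [[e e0 h] i j eij|rev].
  apply: contrapT => /negP eji.
  have ij : i != j by apply: contraNneq eji => ij; rewrite ij edge_self.
  pose t := e / 2.
  have t0 : 0 < t by rewrite divr_gt0.
  pose y := rv a + t *: (evec R i - evec R j).
  have yP : cP y.
    apply: h => [|k].
      apply/(affine_hull_polytopeP _ aP); rewrite /y addrC addKr.
      rewrite -opprB -(real_vector_edge R a) scalerN memvN memvZ //.
      exact: mem_difference_span.
    rewrite /y /evec !mxE eqxx /= opprD addrA subrr add0r normrN normrM gtr0_norm //.
    have : `|(k == i)%:R - (k == j)%:R| <= 1 :> R.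
      by case: eqP => _; case: eqP => _;
        rewrite ?subrr ?subr0 ?sub0r ?normrN ?normr0 ?normr1 ?ler01.
    move=> /(ler_wpM2l (ltW t0)) /le_lt_trans; apply.
    by rewrite mulr1 /t ltr_pdivrMr // ltr_pMr // ltr1n.
  pose U u := edge P a j u.
  have := closed_set_polytope polyP aP
    (fun u v (euv : edge P a u v) (Uu : U u) => edge_trans polyP Uu euv) yP.
  apply/negP; rewrite -ltNge.
  have -> : \sum_(k | U k) y 0 k = \sum_(k | U k) rv a 0 k - t.
    rewrite (eq_bigr (fun k => rv a 0 k + t * (evec R i 0 k - evec R j 0 k))).
      rewrite big_split /= -mulr_sumr sumrB !sum_evec /U edge_self aP.
      by rewrite (negbTE eji) sub0r mulrN1.
    by move=> k _; rewrite !mxE.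
  by rewrite gtrBl.
(* At most n coefficients, each below 1 / (n + 1), have total weight below 1. *)
exists n.+1%:R^-1 => // y Ay near.
pose z := y - rv a.
have zV : z \in difference_span a by apply: affine_hull_polytope.
pose p k := if 0 <= z 0 k then rv (a - evec int (class_min a k) + evec int k)
  else rv (a - evec int k + evec int (class_min a k)).
have -> : y = rv a + \sum_k `|z 0 k| *: (p k - rv a).
  rewrite -[y](subrK (rv a)) addrC -/z {1}(span_star aP rev zV); congr (_ + _).
  apply: eq_bigr => k _; rewrite /p; case: lerP => zk.
    by rewrite ger0_norm // real_vector_edge.
  by rewrite ltr0_norm // real_vector_edge scaleNr -scalerN opprB.
apply: convex_hull_star => //.
- by exists a.
- move=> k; rewrite /p; have e := class_min_edge aP k.
  case: ifP => _; last by exists (a - evec int k + evec int (class_min a k)).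
  by exists (a - evec int (class_min a k) + evec int k) => //; apply: rev.
have zk k : `|z 0 k| <= n.+1%:R^-1.
  by have := near k; rewrite distrC !mxE => /ltW.
rewrite (le_trans (ler_sum _ (fun k _ => zk k))) // sumr_const card_ord.
by rewrite -[_ *+ _]mulr_natr mulrC ler_pdivrMr // mul1r ler_nat.
Qed.

Lemma relint_integer :
  forall x, (relative_interior cP `&` integer_points) x <->
    exists2 a, a \in [fset a in P | int_active P a == ext_active P a]%fset
      & x = rv a.
Proof.
move=> x; split=> [[rx [a _ ax]]|[a]].
  have cx : cP x.
    exact: (@interior_subset (subspace (affine_hull cP))) rx.
  have aP : a \in P by apply: (@polytope_integer R _ _ polyP); rewrite ax.
  exists a => //; rewrite !inE aP /=; apply/eqP/reversible_active.
  by apply/(relint_reversible aP); rewrite ax.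
rewrite !inE => /andP[aP /eqP/active_reversible rev] ->; split; last by exists a.
exact/(relint_reversible aP).
Qed.

Lemma polytope_integer_points :
  forall x, (cP `&` integer_points) x <-> exists2 a, a \in P & x = rv a.
Proof.
move=> x; split=> [[cx [a _ ax]]|[a aP ->]].
  by exists a => //; apply: (@polytope_integer R _ _ polyP); rewrite ax.
by split; [exact: polytope_real_vector | exists a].
Qed.

Lemma minkowski_integer_points (v : 'I_n -> 'rV[int]_n) :
  forall x, (minkowski_difference cP (convex_hull (range (rv \o v)))
             `&` integer_points) x <->
    exists2 c, (forall i, c + v i \in P) & x = rv c.
Proof.
move=> x; split=> [[mx [c _ cx]]|[c cv ->]].
  exists c => // i; apply: (@polytope_integer R _ _ polyP).
  rewrite real_vectorD cx; apply: mx; exists (rv (v i)) => //.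
  by apply: sub_convex_hull; exists i.
split; last by exists c.
move=> _ [d [k [p [w [pv w0 w1 ->]]]] <-].
exists k, (fun i => rv c + p i), w; split=> //.
  move=> i; have [j _ <-] := pv i.
  by exists (c + v j); rewrite ?real_vectorD //=; apply: cv.
under [RHS]eq_bigr do rewrite scalerDr.
by rewrite big_split -scaler_suml w1 scale1r.
Qed.

End Direction.

(** * Evaluations and lattice points *)

Section Evaluations.
Variables (R : realType) (n : nat) (P : {fset 'rV[int]_n.+1}).
Hypothesis polyP : polymatroid P.
Implicit Types a c : 'rV[int]_n.+1.
Let T := tutte_poly P.
Local Notation cP := (@polytope R n.+1 P).
Local Notation rv := (@real_vector R n.+1).

Lemma sum_card_fset (Q : pred 'rV[int]_n.+1) :
  \sum_(a <- P) (Q a)%:R = #|` [fset a in P | Q a]%fset|%:R :> int.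
Proof.
rewrite -natr_sum; congr (_%:R).
have -> : (\sum_(a <- P) Q a = count Q P)%N.
  by rewrite -sum1_count [RHS]big_mkcond; apply: eq_bigr => a _; case: (Q a).
rewrite -size_filter; apply: perm_size; apply: uniq_perm.
- by rewrite filter_uniq ?fset_uniq.
- exact: fset_uniq.
by move=> a; rewrite mem_filter !inE andbC.
Qed.

Lemma expr0_card (A : {set 'I_n.+1}) :
  (0 : int) ^+ #|A| = (A == finset.set0)%:R.
Proof. by rewrite expr0n cards_eq0. Qed.

Lemma bieval_11 : bieval T 1 1 = #|` P|%:R.
Proof.
rewrite bieval_tutte (eq_bigr (fun=> 1)) => [|a _]; last first.
  by rewrite addrK !expr1n !mulr1.
by rewrite big_const_seq count_predT -Monoid.iteropE.
Qed.

(** A power of 0 survives only with exponent 0, which forces the two sets of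
    active indices to agree; x + y - 1 takes the value -1. *)
Lemma bieval_00 : bieval T 0 0 = (-1) ^+ affine_codim cP *
  #|` [fset a in P | int_active P a == ext_active P a]%fset|%:R.
Proof.
rewrite bieval_tutte -sum_card_fset mulr_sumr big_seq [RHS]big_seq.
apply: eq_bigr => a aP; rewrite !expr0_card !finset.setD_eq0 -natrM mulnb -finset.eqEsubset.
case: eqP => [eIE|]; last by rewrite mul0r mulr0.
rewrite mul1r mulr1 add0r (codim_reversible R polyP aP).
  by rewrite -eIE finset.setIid.
exact: active_reversible.
Qed.

Lemma tutte_codim_dvd : bidvd ((polX + polY - 1) ^+ affine_codim cP) T.
Proof.
exists (\sum_(a <- P) polX ^+ #|(int_active P a :\: ext_active P a)%SET| *
  polY ^+ #|(ext_active P a :\: int_active P a)%SET| * (polX + polY - 1) ^+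
  (#|(int_active P a :&: ext_active P a)%SET| - affine_codim cP)).
rewrite mulr_sumr /T /tutte_poly big_seq [RHS]big_seq; apply: eq_bigr => a aP.
by rewrite mulrCA -exprD subnKC // codim_le_active.
Qed.

Let S := \sum_(a <- P)
    polX ^+ #|(int_active P a :\: ext_active P a)%SET| *
    polY ^+ #|(ext_active P a :\: int_active P a)%SET| *
    (polX + polY - 1) ^+ #|(int_active P a :&: ext_active P a)%SET|.-1.

Let bieval_S (s t : int) : bieval S s t = \sum_(a <- P)
    s ^+ #|(int_active P a :\: ext_active P a)%SET| *
    t ^+ #|(ext_active P a :\: int_active P a)%SET| *
    (s + t - 1) ^+ #|(int_active P a :&: ext_active P a)%SET|.-1.
Proof.
rewrite /bieval raddf_sum; apply: eq_bigr => a _.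
rewrite /= !rmorphM !rmorphXn /= rmorphB rmorphD rmorph1 /=.
by rewrite ![meval _ polX](bieval_X s t) ![meval _ polY](bieval_Y s t).
Qed.

(* The powers of 0 at (1, 0) and at (0, 1) are nonzero only if one of the sets
   of active indices is contained in the other and has one element. *)
Let only_index0 (A B : {set 'I_n.+1}) : ord0 \in (A :&: B)%SET ->
  ((B :\: A)%SET == finset.set0) && (#|(A :&: B)%SET|.-1 == 0)%N =
  (B == [set ord0]%SET).
Proof.
move=> AB0; have /andP[A0 B0] : (ord0 \in A) && (ord0 \in B).
  by rewrite -finset.in_setI.
rewrite finset.setD_eq0; apply/andP/eqP => [[/finset.setIidPr -> cB]|->].
  apply/esym/eqP; rewrite eqEcard finset.sub1set B0 cards1.
  by move: cB; case: #|B| => [|[|]].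
by rewrite finset.sub1set A0 (finset.setIidPr _) ?finset.sub1set // cards1.
Qed.

Lemma bieval_S10 :
  bieval S 1 0 = #|` [fset a in P | ext_active P a == [set ord0]%SET]%fset|%:R.
Proof.
rewrite bieval_S -sum_card_fset big_seq [RHS]big_seq.
apply: eq_bigr => a /index0_active h.
by rewrite expr1n mul1r addr0 subrr expr0_card expr0n -natrM mulnb only_index0.
Qed.

Lemma bieval_S01 :
  bieval S 0 1 = #|` [fset a in P | int_active P a == [set ord0]%SET]%fset|%:R.
Proof.
rewrite bieval_S -sum_card_fset big_seq [RHS]big_seq.
apply: eq_bigr => a /index0_active; rewrite finset.setIC => h.
by rewrite expr1n mulr1 add0r subrr expr0_card expr0n -natrM mulnb only_index0.
Qed.

(** If the smallest index is the only one externally active, every other index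
    has an edge from a smaller one; following these down to the smallest index,
    transitivity gives a single edge. *)
Lemma ext_active1 a : a \in P ->
  ext_active P a = [set ord0]%SET <-> forall i, edge P a ord0 i.
Proof.
move=> aP; split=> [ext i|h].
  have [m] := ubnP (i : nat); elim: m i => // m IH i im.
  have [->|i0] := eqVneq i ord0; first by rewrite edge_self.
  have : i \notin ext_active P a by rewrite ext finset.in_set1.
  rewrite ext_activeE negbK => /existsP[j /andP[ji e]].
  by apply: (edge_trans polyP _ e); apply: IH; rewrite (leq_trans ji).
apply/setP => i; rewrite finset.in_set1 ext_activeE.
have [->|i0] := eqVneq i ord0; first by apply/existsPn.
by apply/negbTE; rewrite negbK; apply/existsP; exists ord0; rewrite h lt0n i0.
Qed.

Lemma int_active1 a : a \in P ->
  int_active P a = [set ord0]%SET <-> forall i, edge P a i ord0.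
Proof.
move=> aP; split=> [int i|h].
  have [m] := ubnP (i : nat); elim: m i => // m IH i im.
  have [->|i0] := eqVneq i ord0; first by rewrite edge_self.
  have : i \notin int_active P a by rewrite int finset.in_set1.
  rewrite int_activeE negbK => /existsP[j /andP[ji e]].
  by apply: (edge_trans polyP e); apply: IH; rewrite (leq_trans ji).
apply/setP => i; rewrite finset.in_set1 int_activeE.
have [->|i0] := eqVneq i ord0; first by apply/existsPn.
by apply/negbTE; rewrite negbK; apply/existsP; exists ord0; rewrite h lt0n i0.
Qed.

Let has_card_translate (D : set 'rV[R]_n.+1) (Q : pred 'rV[int]_n.+1) e :
  (forall x, D x <-> exists2 c, c + e \in P /\ Q (c + e) & x = rv c) ->
  has_card D #|` [fset a in P | Q a]%fset|.
Proof.
move=> DE; pose F := [fset a - e | a in [fset a in P | Q a]]%fset.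
have -> : #|` [fset a in P | Q a]%fset| = #|` F|.
  by rewrite [RHS]card_imfset //= => a b /addIr.
apply: has_card_real_vector => x; rewrite DE; split=> [[c [cP Qc] ->]|[c + ->]].
  by exists c => //; apply/imfsetP; exists (c + e); rewrite ?addrK //= !inE cP.
case/imfsetP=> a /=; rewrite !inE => /andP[aP Qa] ->.
by exists (a - e) => //; rewrite subrK.
Qed.

Lemma card_minkowski_simplex :
  has_card (minkowski_difference cP (@simplex R n.+1) `&` integer_points)
    #|` [fset a in P | ext_active P a == [set ord0]%SET]%fset|.
Proof.
have evecE : @evec R n.+1 = rv \o @evec int n.+1.
  by apply/funext => i /=; rewrite real_vector_evec.
rewrite /simplex evecE.
apply: (has_card_translate (e := evec int ord0)) => x.
rewrite minkowski_integer_points //.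
have edgeE c i : edge P (c + evec int ord0) ord0 i = (c + evec int i \in P).
  by rewrite /edge addrK.
split=> -[c cv ->]; exists c => //.
  split=> //; apply/eqP/ext_active1 => // i; by rewrite edgeE.
by case: cv => cP /eqP/(ext_active1 cP) h i; rewrite -edgeE.
Qed.

Lemma card_minkowski_opp_simplex :
  has_card (minkowski_difference cP (@opp_simplex R n.+1) `&` integer_points)
    #|` [fset a in P | int_active P a == [set ord0]%SET]%fset|.
Proof.
have evecE : (fun i => - @evec R n.+1 i) = rv \o (fun i => - @evec int n.+1 i).
  by apply/funext => i /=; rewrite -real_vector_evec -[RHS]/(map_mx _ _) map_mxN.
rewrite /opp_simplex evecE.
apply: (has_card_translate (e := - evec int ord0)) => x.
rewrite minkowski_integer_points //.
have edgeE c i : edge P (c - evec int ord0) i ord0 = (c - evec int i \in P).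
  by rewrite /edge addrAC subrK.
split=> -[c cv ->]; exists c => //.
  split=> //; apply/eqP/int_active1 => // i; by rewrite edgeE.
by case: cv => cP /eqP/(int_active1 cP) h i; rewrite -edgeE.
Qed.

Lemma tutte_quotient : exists2 S : bipoly, T = (polX + polY - 1) * S &
     (exists2 N : nat,
        has_card (minkowski_difference cP simplex `&` integer_points) N
        & bieval S 1 0 = N%:R) /\
     (exists2 N : nat,
        has_card (minkowski_difference cP opp_simplex `&` integer_points) N
        & bieval S 0 1 = N%:R).
Proof.
exists S; first exact: tutte_factor.
split; eexists; [exact: card_minkowski_simplex | exact: bieval_S10
  | exact: card_minkowski_opp_simplex | exact: bieval_S01].
Qed.

End Evaluations.

Theorem proposition4p11 (R : realType) (n : nat) (P : {fset 'rV[int]_n.+1})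
    (hP : polymatroid P) :
  let T := tutte_poly P in
  let cP : set 'rV[R]_n.+1 := polytope P in
  (* (a) *)
  has_degree T n.+1
  /\ (* (b) *)
  [/\ forall k l : nat, 0 <= bicoef (bisubst T polX (polY + 1)) k l,
      forall k l : nat, 0 <= bicoef (bisubst T (polX + 1) polY) k l,
      exists k l : nat, 0 < bicoef T k l
    & exists k l : nat, bicoef T k l < 0]
  /\ (* (c) *)
  bidvd ((polX + polY - 1) ^+ affine_codim cP) T
  /\ (* (d) *)
  (top_component T = (polX + polY) ^+ n.+1 /\
   forall k : nat, (k <= n.+1)%N -> bicoef T k (n.+1 - k) = 'C(n.+1, k)%:R)
  /\ (* (e) *)
  (forall (m : nat) (Q : {fset 'rV[int]_m.+1}), polymatroid Q ->
     tutte_poly (direct_sum P Q) = T * tutte_poly Q /\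
     (polX + polY - 1) * tutte_poly (aggregated_sum P Q) = T * tutte_poly Q)
  /\ (* (f) *)
  (forall i : 'I_n.+1,
     (pm_gap P i = 0 -> T = (polX + polY - 1) * tutte_poly (pm_projection i P)) /\
     (pm_gap P i = 1 ->
        T = polX * tutte_poly (pm_deletion i P) + polY * tutte_poly (pm_contraction i P)))
  /\ (* (g) *)
  [/\ bieval T 1 1 = #|` P|%:R,
      has_card (cP `&` integer_points) #|` P|
    & exists2 N : nat, has_card (relative_interior cP `&` integer_points) N
        & bieval T 0 0 = (-1) ^+ affine_codim cP * N%:R]
  /\ (* (h) *)
  (exists2 S : bipoly, T = (polX + polY - 1) * S &
     (exists2 N : nat,
        has_card (minkowski_difference cP simplex `&` integer_points) N
        & bieval S 1 0 = N%:R) /\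
     (exists2 N : nat,
        has_card (minkowski_difference cP opp_simplex `&` integer_points) N
        & bieval S 0 1 = N%:R)).
Proof.
move=> T cP; split; first exact: tutte_degree.
split; first split.
- exact: nonneg_tutte_Y1.
- exact: nonneg_tutte_X1.
- by exists n.+1, 0%N; apply: tutte_pos_coef.
- exact: tutte_neg_coef.
split; first exact: tutte_codim_dvd.
split; first by split; [exact: tutte_top_component | exact: bicoef_tutte_top].
split.
  by move=> m Q hQ; split; [exact: tutte_direct_sum | exact: tutte_aggregated_sum].
split; first by move=> i; split; [exact: tutte_gap0 | exact: tutte_gap1].
split; last exact: tutte_quotient.
split; first exact: bieval_11.
  exact/has_card_real_vector/polytope_integer_points.
eexists; last exact: bieval_00.
exact/has_card_real_vector/relint_integer.
Qed.
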